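(* Let $n,m\in\mathbb{N}$ and let $A_k\in\mathbb{R}^{n\times n}$, $B_k\in\mathbb{R}^{n\times m}$, $Q_k\in\mathbb{S}^n_+$, $R_k\in\mathbb{S}^m_{++}$ ($k\in\mathbb{N}_0$) be problem data such that: $\|A_k\|_2,\|B_k\|_2,\|Q_k\|_2,\|R_k\|_2$ are bounded uniformly in $k$; every $A_k$ is non-singular; there is $d\in\mathbb{N}$ such that for all $k\in\mathbb{N}_0$ the $d$-step controllability matrix $\mathcal{C}_{k,d}$ has full row rank and the $d$-step observability matrix $\mathcal{O}_{k,d}$ has full column rank; and, for the lifted data $(\tilde A_t,\tilde B_t,\tilde Q_t,\tilde R_t)_{t\in\mathbb{N}_0}$ constructed with this $d$, $\inf_{t}\lambda_{\min}(\tilde Q_t)>0$, $\inf_{t}\lambda_{\min}(\tilde B_t\tilde B_t')>0$, and $\inf_{t}\lambda_{\min}(\tilde A_t\tilde A_t')>0$. Let $\mathcal{R}_t$ be the Riccati operator of the lifted data and $(P_t)_{t\in\mathbb{N}_0}$ the bounded positive definite solution of $P_t=\mathcal{R}_t(P_{t+1})$. Given $T\in\mathbb{N}$, consider the $T$-step receding-horizon policy $\tilde u_t=\mu_0^{RH}(t,\tilde x_t)$ with terminal penalty matrices $$X_{t+T}=\tilde Q_{t+T}+\tilde A_{t+T}'(\tilde B_{t+T}\tilde B_{t+T}')^{-1}\tilde B_{t+T}\tilde R_{t+T}\tilde B_{t+T}'(\tilde B_{t+T}\tilde B_{t+T}')^{-1}\tilde A_{t+T},\qquad t\in\mathbb{N}_0.$$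 For $t\in\mathbb{N}_0$ let $\hat X_{t+1}:=\mathcal{R}_{t+1}\circ\cdots\circ\mathcal{R}_{t+T-1}(X_{t+T})$ (so $\hat X_{t+1}=X_{t+1}$ if $T=1$) and $K_t:=(\tilde R_t+\tilde B_t'\hat X_{t+1}\tilde B_t)^{-1}\tilde B_t'\hat X_{t+1}\tilde A_t$, and define $$\overline\omega:=\sup_{t\in\mathbb{N}_0}\|\mathcal{R}_t(\hat X_{t+1})\|_2,\quad \underline\omega:=\inf_{t\in\mathbb{N}_0}\lambda_{\min}(\mathcal{R}_t(\hat X_{t+1})),\quad \underline\lambda:=\inf_{t\in\mathbb{N}_0}\lambda_{\min}(\tilde Q_t+K_t'\tilde R_tK_t),\quad \overline\lambda:=\sup_{t\in\mathbb{N}_0}\|P_t\|_2,$$ $$\overline\delta:=\sqrt n\,\log\Big(\sup_{t\in\mathbb{N}_0}\frac{\|X_{t+T}\|_2}{\lambda_{\min}(P_{t+T})}\Big),\qquad \overline\zeta:=\sup_{t\in\mathbb{N}_0}\zeta_t,\qquad \underline\epsilon:=\inf_{t\in\mathbb{N}_0}\epsilon_t,$$ where $$\zeta_t:=\big\|(\tilde Q_t+\tilde Q_t\tilde A_t^{-1}\tilde B_t\tilde R_t^{-1}\tilde B_t'(\tilde A_t')^{-1}\tilde Q_t)^{-1}\big\|_2,$$ $$\epsilon_t:=\lambda_{\min}\big(\tilde A_t^{-1}\tilde B_t(\tilde R_t+\tilde B_t'(\tilde A_t')^{-1}\tilde Q_t\tilde A_t^{-1}\tilde B_t)^{-1}\tilde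 B_t'(\tilde A_t')^{-1}\big).$$ Then $\overline\zeta<+\infty$, $\underline\epsilon>0$, the constants $\overline\omega,\underline\omega,\underline\lambda,\overline\lambda,\overline\delta$ are finite and strictly positive, and for all initial states $\xi\in\mathbb{R}^n$ the infinite-horizon performance loss of the receding-horizon policy satisfies $$\beta(\xi)\le\frac{\overline\lambda}{\underline\lambda}\,\frac{\overline\omega}{\underline\omega}\,\overline\omega\left(\exp\left(\Big(\frac{\overline\zeta}{\overline\zeta+\underline\epsilon}\Big)^{T-1}\overline\delta\right)-1\right)|\xi|^2.$$
   Context: Notation: $\mathbb{N}_0=\mathbb{N}\cup\{0\}$; $M'$ is the transpose; $|\cdot|$ is the Euclidean norm, $\|\cdot\|_2$ the induced (spectral) norm; $\mathbb{S}^n,\mathbb{S}^n_+,\mathbb{S}^n_{++}$ are the real symmetric, positive semi-definite, positive definite $n\times n$ matrices; $\lambda_{\min}$ is the smallest eigenvalue. Controllability and observability matrices: $\Theta_{k,d}:=A_{k+d-1}A_{k+d-2}\cdots A_k$, $\Theta_{k,0}:=I_n$, $C_k:=Q_k^{1/2}$, $\mathcal{C}_{k,d}:=[\,\Theta_{k+1,d-1}B_k\;\;\Theta_{k+2,d-2}B_{k+1}\;\cdots\;\Theta_{k+d,0}B_{k+d-1}\,]$, and $\mathcal{O}_{k,d}$ is the vertical stack of $C_k\Theta_{k,0},\,C_{k+1}\Theta_{k,1},\dots,C_{k+d}\Theta_{k,d}$. Lifted data: for $t\in\mathbb{N}_0$, $\hat A_t:=I_{n(d+1)}-\begin{bmatrix}0_{n,nd}&0_{n,n}\\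 \mathrm{diag}(A_{dt},\dots,A_{d(t+1)-1})&0_{nd,n}\end{bmatrix}$, $\hat B_t:=\begin{bmatrix}0_{n,md}\\ \mathrm{diag}(B_{dt},\dots,B_{d(t+1)-1})\end{bmatrix}$, $\hat C_t:=[\,\mathrm{diag}(C_{dt},\dots,C_{d(t+1)-1})\;\;0_{nd,n}\,]$ (block-diagonal matrices); $\Phi_t:=[0_{n,nd}\;I_n]\hat A_t^{-1}\begin{bmatrix}I_n\\0_{nd,n}\end{bmatrix}$, $\Gamma_t:=[0_{n,nd}\;I_n]\hat A_t^{-1}\hat B_t$, $\Xi_t:=\hat C_t\hat A_t^{-1}\begin{bmatrix}I_n\\0_{nd,n}\end{bmatrix}$, $\Delta_t:=\hat C_t\hat A_t^{-1}\hat B_t$; $\tilde R_t:=\mathrm{diag}(R_{dt},\dots,R_{dt+d-1})+\Delta_t'\Delta_t$, $\tilde Q_t:=\Xi_t'\Xi_t-\Xi_t'\Delta_t\tilde R_t^{-1}\Delta_t'\Xi_t$, $\tilde A_t:=\Phi_t-\Gamma_t\tilde R_t^{-1}\Delta_t'\Xi_t$, $\tilde B_t:=\Gamma_t$. Riccati operator: $\mathcal{R}_t(P):=\tilde Q_t+\tilde A_t'\big(P-P\tilde B_t(\tilde R_t+\tilde B_t'P\tilde B_t)^{-1}\tilde B_t'P\big)\tilde A_t$ for $P\in\mathbb{S}^n_+$. Under the stated hypotheses the recursion $P_t=\mathcal{R}_t(P_{t+1})$, $t\in\mathbb{N}_0$ (no boundary condition), has a unique bounded positive semi-definite solution $(P_t)_{t\in\mathbb{N}_0}$,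 and it is positive definite (known background fact). Receding-horizon policy: for $t\in\mathbb{N}_0$, $\chi\in\mathbb{R}^n$, $w=(w_t,\dots,w_{t+T-1})\in((\mathbb{R}^m)^d)^T$, $X\in\mathbb{S}^n_{++}$, let $z_t=\chi$, $z_{j+1}=\tilde A_jz_j+\tilde B_jw_j$ for $t\le j\le t+T-1$, and $L_T(t,\chi,w,X):=\sum_{j=t}^{t+T-1}(z_j'\tilde Q_jz_j+w_j'\tilde R_jw_j)+z_{t+T}'Xz_{t+T}$. The policy is defined by $(\mu^{RH}_0(t,\tilde x_t),\dots,\mu^{RH}_{T-1}(t,\tilde x_t))=\arg\min_{w}L_T(t,\tilde x_t,w,X_{t+T})$, and only the first element $\mu_0^{RH}$ is applied. Performance loss: for an input sequence $\tilde u=(\tilde u_0,\tilde u_1,\dots)$ in $(\mathbb{R}^m)^d$, let $\tilde x_0=\xi$, $\tilde x_{t+1}=\tilde A_t\tilde x_t+\tilde B_t\tilde u_t$, and $J(0,\xi,\tilde u):=\lim_{N\to\infty}\sum_{t=0}^{N-1}(\tilde x_t'\tilde Q_t\tilde x_t+\tilde u_t'\tilde R_t\tilde u_t)$. The performance loss is $\beta(\xi):=J(0,\xi,\tilde u)-\min_{\tilde v}J(0,\xi,\tilde v)$, with $\tilde u$ the input generated by the policy under consideration from $\tilde x_0=\xi$ and the minimum over all input sequences $\tilde v$; the minimum equals $\xi'P_0\xi$ (known background fact). *)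

(* Defs.v *)
From HB Require Import structures.
From mathcomp Require Import all_boot all_order all_algebra.
From mathcomp Require Import all_classical all_reals all_analysis.

Set Implicit Arguments.
Unset Strict Implicit.
Unset Printing Implicit Defensive.

Import Order.TTheory GRing.Theory Num.Theory.
Import numFieldNormedType.Exports.

Local Open Scope classical_set_scope.
Local Open Scope ring_scope.

(* The library norm on matrices is the max norm, so the Euclidean norm and the
   operator norm it induces are defined here. *)
Definition enorm (R : realType) (n : nat) (v : 'cV[R]_n) : R :=
  Num.sqrt (\sum_(i < n) v i 0 ^+ 2).

Definition opnorm (R : realType) (m n : nat) (M : 'M[R]_(m, n)) : R :=
  sup [set enorm (M *m v) | v in [set v : 'cV[R]_n | enorm v <= 1]].

Definition qform (R : realType) (n : nat) (M : 'M[R]_n) (v : 'cV[R]_n) : R :=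
  (v^T *m M *m v) 0 0.

Definition psd (R : realType) (n : nat) (M : 'M[R]_n) : Prop :=
  M^T = M /\ forall v : 'cV[R]_n, 0 <= qform M v.

Definition posdef (R : realType) (n : nat) (M : 'M[R]_n) : Prop :=
  M^T = M /\ forall v : 'cV[R]_n, v != 0 -> 0 < qform M v.

(* Only used for symmetric matrices of positive size; the set is then finite
   and nonempty, so that the infimum is its least element. *)
Definition lambda_min (R : realType) (n : nat) (M : 'M[R]_n) : R :=
  inf [set a : R | eigenvalue M a].

Definition psd_sqrt (R : realType) (n : nat) (M : 'M[R]_n) : 'M[R]_n :=
  xget 0 [set S : 'M[R]_n | psd S /\ S *m S = M].

Definition esup_seq (R : realType) (f : nat -> R) : \bar R :=
  ereal_sup (range (fun t => (f t)%:E)).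

Definition einf_seq (R : realType) (f : nat -> R) : \bar R :=
  ereal_inf (range (fun t => (f t)%:E)).

(* Data of a time-varying linear-quadratic problem with n states and p inputs;
   it serves both for the original and for the lifted problem. *)
Record lq_data (R : realType) (n p : nat) := LQData {
  lqA : nat -> 'M[R]_n;
  lqB : nat -> 'M[R]_(n, p);
  lqQ : nat -> 'M[R]_n;
  lqR : nat -> 'M[R]_p
}.

Section Lifting.
Variables (R : realType) (n m : nat) (D : lq_data R n m).

Local Notation A := (lqA D).
Local Notation B := (lqB D).

Definition lqC (k : nat) : 'M[R]_n := psd_sqrt (lqQ D k).

(* Theta k d = A_(k+d-1) ... A_(k+1) A_k *)
Fixpoint Theta (k d : nat) : 'M[R]_n :=
  if d is d'.+1 then A (k + d') *m Theta k d' else 1%:M.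

Definition controllability_mx (k d : nat) : 'M[R]_(n, \sum_(i < d) m) :=
  \mxrow_(i < d) (Theta (k + i.+1) (d - i.+1) *m B (k + i)).

Definition observability_mx (k d : nat) : 'M[R]_(\sum_(i < d.+1) n, n) :=
  \mxcol_(i < d.+1) (lqC (k + i) *m Theta k i).

(* In the lifted matrices, block (j+1, j) of an array with d+1 block rows
   is block j of a block diagonal shifted down by one zero block row. *)
Definition liftA (d t : nat) : 'M[R]_(\sum_(i < d.+1) n) :=
  1%:M - \mxblock_(i < d.+1, j < d.+1)
    (if i == j.+1 :> nat then A (d * t + j) else 0 : 'M[R]_n).

Definition liftB (d t : nat) : 'M[R]_(\sum_(i < d.+1) n, \sum_(j < d) m) :=
  \mxblock_(i < d.+1, j < d)
    (if i == j.+1 :> nat then B (d * t + j) else 0 : 'M[R]_(n, m)).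

Definition liftC (d t : nat) : 'M[R]_(\sum_(i < d) n, \sum_(j < d.+1) n) :=
  \mxblock_(i < d, j < d.+1)
    (if i == j :> nat then lqC (d * t + i) else 0 : 'M[R]_n).

Definition first_block (d : nat) : 'M[R]_(\sum_(i < d.+1) n, n) :=
  \mxcol_(i < d.+1) (if i == ord0 then 1%:M else 0 : 'M[R]_n).

Definition last_block (d : nat) : 'M[R]_(n, \sum_(i < d.+1) n) :=
  \mxrow_(i < d.+1) (if i == ord_max then 1%:M else 0 : 'M[R]_n).

Definition Phi (d t : nat) : 'M[R]_n :=
  last_block d *m invmx (liftA d t) *m first_block d.

Definition Gamma (d t : nat) : 'M[R]_(n, \sum_(i < d) m) :=
  last_block d *m invmx (liftA d t) *m liftB d t.

Definition Xi (d t : nat) : 'M[R]_(\sum_(i < d) n, n) :=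
  liftC d t *m invmx (liftA d t) *m first_block d.

Definition Delta (d t : nat) : 'M[R]_(\sum_(i < d) n, \sum_(i < d) m) :=
  liftC d t *m invmx (liftA d t) *m liftB d t.

Definition Rtilde (d t : nat) : 'M[R]_(\sum_(i < d) m) :=
  \mxdiag_(i < d) (lqR D (d * t + i)) + (Delta d t)^T *m Delta d t.

Definition Qtilde (d t : nat) : 'M[R]_n :=
  (Xi d t)^T *m Xi d t
  - (Xi d t)^T *m Delta d t *m invmx (Rtilde d t) *m (Delta d t)^T *m Xi d t.

Definition Atilde (d t : nat) : 'M[R]_n :=
  Phi d t - Gamma d t *m invmx (Rtilde d t) *m (Delta d t)^T *m Xi d t.

Definition lifted (d : nat) : lq_data R n (\sum_(i < d) m) :=
  LQData (Atilde d) (Gamma d) (Qtilde d) (Rtilde d).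

End Lifting.

Section RecedingHorizon.
Variables (R : realType) (n p : nat) (L : lq_data R n p).

Local Notation A := (lqA L).
Local Notation B := (lqB L).
Local Notation Q := (lqQ L).
Local Notation W := (lqR L).

Definition riccati (t : nat) (P : 'M[R]_n) : 'M[R]_n :=
  Q t + (A t)^T *m
    (P - P *m B t *m invmx (W t + (B t)^T *m P *m B t) *m (B t)^T *m P) *m A t.

(* riccati_comp s j = riccati s \o riccati (s+1) \o ... \o riccati (s+j-1) *)
Fixpoint riccati_comp (s j : nat) (P : 'M[R]_n) : 'M[R]_n :=
  if j is j'.+1 then riccati s (riccati_comp s.+1 j' P) else P.

(* State at time t + j when starting from chi at time t; the input u is
   indexed relatively to t. *)
Fixpoint trajectory (t : nat) (chi : 'cV[R]_n) (u : nat -> 'cV[R]_p) (j : nat)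
    : 'cV[R]_n :=
  if j is j'.+1 then
    A (t + j') *m trajectory t chi u j' + B (t + j') *m u j'
  else chi.

Definition stage_cost (t : nat) (x : 'cV[R]_n) (u : 'cV[R]_p) : R :=
  qform (Q t) x + qform (W t) u.

Definition extend0 (T : nat) (w : {ffun 'I_T -> 'cV[R]_p}) (j : nat)
    : 'cV[R]_p :=
  if insub j is Some i then w i else 0.

Definition horizon_cost (T t : nat) (chi : 'cV[R]_n)
    (w : {ffun 'I_T -> 'cV[R]_p}) (X : 'M[R]_n) : R :=
  let z := trajectory t chi (extend0 w) in
  \sum_(j < T) stage_cost (t + j) (z j) (w j) + qform X (z T).

Definition horizon_argmin (T t : nat) (chi : 'cV[R]_n) (X : 'M[R]_n)
    : {ffun 'I_T -> 'cV[R]_p} :=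
  xget 0 [set w | forall w' : {ffun 'I_T -> 'cV[R]_p},
                    horizon_cost t chi w X <= horizon_cost t chi w' X].

Definition mu_RH (T : nat) (X : nat -> 'M[R]_n) (t : nat) (x : 'cV[R]_n)
    : 'cV[R]_p :=
  extend0 (horizon_argmin T t x (X (t + T)%N)) 0%N.

Fixpoint RH_state (T : nat) (X : nat -> 'M[R]_n) (xi : 'cV[R]_n) (t : nat)
    : 'cV[R]_n :=
  if t is t'.+1 then
    let x := RH_state T X xi t' in A t' *m x + B t' *m mu_RH T X t' x
  else xi.

Definition RH_input (T : nat) (X : nat -> 'M[R]_n) (xi : 'cV[R]_n) (t : nat)
    : 'cV[R]_p :=
  mu_RH T X t (RH_state T X xi t).

Definition total_cost (xi : 'cV[R]_n) (u : nat -> 'cV[R]_p) : \bar R :=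
  limn (fun N => (\sum_(0 <= t < N)
                    stage_cost t (trajectory 0 xi u t) (u t))%:E).

Definition optimal_cost (xi : 'cV[R]_n) : \bar R :=
  ereal_inf (range (total_cost xi)).

Definition performance_loss (xi : 'cV[R]_n) (u : nat -> 'cV[R]_p) : \bar R :=
  (total_cost xi u - optimal_cost xi)%E.

Definition terminal_penalty (t : nat) : 'M[R]_n :=
  let G := invmx (B t *m (B t)^T) in
  Q t + (A t)^T *m G *m B t *m W t *m (B t)^T *m G *m A t.

Definition Xhat_next (T : nat) (X : nat -> 'M[R]_n) (t : nat) : 'M[R]_n :=
  riccati_comp t.+1 T.-1 (X (t + T)%N).

Definition RH_gain (T : nat) (X : nat -> 'M[R]_n) (t : nat) : 'M[R]_(p, n) :=
  let Y := Xhat_next T X t in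
  invmx (W t + (B t)^T *m Y *m B t) *m (B t)^T *m Y *m A t.

Definition omega_up (T : nat) (X : nat -> 'M[R]_n) : \bar R :=
  esup_seq (fun t => opnorm (riccati t (Xhat_next T X t))).

Definition omega_low (T : nat) (X : nat -> 'M[R]_n) : \bar R :=
  einf_seq (fun t => lambda_min (riccati t (Xhat_next T X t))).

Definition lambda_low (T : nat) (X : nat -> 'M[R]_n) : \bar R :=
  einf_seq (fun t =>
    let K := RH_gain T X t in lambda_min (Q t + K^T *m W t *m K)).

Definition lambda_up (P : nat -> 'M[R]_n) : \bar R :=
  esup_seq (fun t => opnorm (P t)).

Definition delta_up (T : nat) (X P : nat -> 'M[R]_n) : \bar R :=
  ((Num.sqrt n%:R)%:E
   * lne (esup_seq (fun t =>
       (opnorm (X (t + T)%N) / lambda_min (P (t + T)%N))%R)))%E.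

Definition zeta (t : nat) : R :=
  opnorm (invmx (Q t + Q t *m invmx (A t) *m B t *m invmx (W t) *m (B t)^T
                       *m invmx (A t)^T *m Q t)).

Definition epsilon (t : nat) : R :=
  lambda_min
    (invmx (A t) *m B t
     *m invmx (W t + (B t)^T *m invmx (A t)^T *m Q t *m invmx (A t) *m B t)
     *m (B t)^T *m invmx (A t)^T).

Definition zeta_up : \bar R := esup_seq zeta.

Definition epsilon_low : \bar R := einf_seq epsilon.

Definition loss_bound (T : nat) (X P : nat -> 'M[R]_n) (xi : 'cV[R]_n) : R :=
  let wu := fine (omega_up T X) in
  let wl := fine (omega_low T X) in
  let lu := fine (lambda_up P) in
  let ll := fine (lambda_low T X) in
  let z := fine zeta_up in
  let e := fine epsilon_low in
  let dl := fine (delta_up T X P) in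
  lu / ll * (wu / wl) * wu * (expR ((z / (z + e)) ^+ T.-1 * dl) - 1)
  * enorm xi ^+ 2.

End RecedingHorizon.

(* Main.v *)
(* The receding-horizon value function W_t = R_t(hatX_{t+1}) dominates the
   closed-loop cost-to-go, because the terminal penalty X (the cost of steering
   the state to zero in one lifted step) satisfies R_t(X_{t+1}) <= X_t, so the
   closed-loop cost is at most xi' W_0 xi while the optimum is xi' P_0 xi.  The
   Riccati operator contracts the order-theoretic distance to P: if
   Y <= exp(s) P_{t+1} then R_t(Y) <= exp(rho s) P_t with
   rho = zeta / (zeta + epsilon).  This is read off the inverse: by convex
   duality R_t(Y)^-1 is a concave function of Y^-1 with value E at 0, where
   E >= epsilon and R_t(Y)^-1 - E <= zeta.  Hence W_0 <= exp(rho^(T-1) delta) P_0,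
   and the remaining factors of the bound are at least 1.

   The R_k are not assumed uniformly positive, so R~^-1 may be unbounded and the
   boundedness of A~ is not immediate.  It follows from a determinant argument:
   A~ is a corner of the inverse of a block matrix, whence
   |det A~| <= |det Phi|, and A~ = det(A~) adj(A~^-1) with A~^-1 bounded. *)
Require Import Defs.
From HB Require Import structures.
From mathcomp Require Import all_boot all_order all_algebra all_fingroup.
From mathcomp Require Import all_classical all_reals all_analysis.
From mathcomp Require Import ring lra.

Set Implicit Arguments.
Unset Strict Implicit.
Unset Printing Implicit Defensive.

Import Order.TTheory GRing.Theory Num.Theory.
Import numFieldNormedType.Exports.

Local Open Scope classical_set_scope.
Local Open Scope ring_scope.

(** * Quadratic forms *)

(** Why these two constants: with [T = A^-1 B], the Woodbury identity turns the matrix inverted in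
    [zeta] into one whose inverse is [Q^-1 - E], where [E = T (W + T' Q T)^-1 T'] is the matrix in
    [epsilon]. As R_t(Y) >= Q, this gives R_t(Y)^-1 - E <= zeta. Concavity yields R_t(e^s Z)^-1 >= c
    R_t(Z)^-1 + (1 - c) E with c = e^-s, and convexity of the exponential gives e^(-rho s) <= (1 -
    rho) + rho c. Together they give R_t(e^s Z)^-1 >= e^(-rho s) R_t(Z)^-1. The upper bound on
    [Atilde] is needed twice: to bound the terminal penalties, hence [omega_up] and [delta_up], and
    to keep [epsilon] away from 0, since [E] involves [Atilde^-1], which must not shrink vectors too
    much. The argument yields exponent T and the logarithm without the factor sqrt n; the stated T -
    1 and sqrt n are weaker. Strict positivity of [delta_up] is a separate point: steering to zero
    in one step is never optimal from a nonzero state, so the ratio under the logarithm exceeds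
    1. *)

Definition dot (R : realType) (n : nat) (x y : 'cV[R]_n) : R := (x^T *m y) 0 0.

Section Dot.
Context {R : realType}.
Implicit Types n p : nat.

Lemma dotE n (x y : 'cV[R]_n) : dot x y = \sum_i x i 0 * y i 0.
Proof. by rewrite /dot mxE; apply: eq_bigr => i _; rewrite mxE. Qed.

Lemma dotC n (x y : 'cV[R]_n) : dot x y = dot y x.
Proof. by rewrite !dotE; apply: eq_bigr => i _; rewrite mulrC. Qed.

Lemma dotDr n (x y z : 'cV[R]_n) : dot x (y + z) = dot x y + dot x z.
Proof. by rewrite /dot mulmxDr mxE. Qed.

Lemma dotDl n (x y z : 'cV[R]_n) : dot (x + y) z = dot x z + dot y z.
Proof. by rewrite !(dotC _ z) dotDr. Qed.

Lemma dotZr n (a : R) (x y : 'cV[R]_n) : dot x (a *: y) = a * dot x y.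
Proof. by rewrite /dot -scalemxAr mxE. Qed.

Lemma dotZl n (a : R) (x y : 'cV[R]_n) : dot (a *: x) y = a * dot x y.
Proof. by rewrite !(dotC _ y) dotZr. Qed.

Lemma dotNr n (x y : 'cV[R]_n) : dot x (- y) = - dot x y.
Proof. by rewrite -scaleN1r dotZr mulN1r. Qed.

Lemma dotNl n (x y : 'cV[R]_n) : dot (- x) y = - dot x y.
Proof. by rewrite !(dotC _ y) dotNr. Qed.

Lemma dot0r n (x : 'cV[R]_n) : dot x 0 = 0.
Proof. by rewrite /dot mulmx0 mxE. Qed.

Definition dotL := (dotDl, dotDr, dotNl, dotNr, dotZl, dotZr).

Lemma dot_mulmxl n p (M : 'M[R]_(n, p)) x y : dot (M *m x) y = dot x (M^T *m y).
Proof. by rewrite /dot trmx_mul mulmxA. Qed.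

Lemma dot_mulmxr n p (M : 'M[R]_(n, p)) x y : dot x (M *m y) = dot (M^T *m x) y.
Proof. by rewrite dot_mulmxl trmxK. Qed.

Lemma dot_symm n (M : 'M[R]_n) x y :
  M^T = M -> dot x (M *m y) = dot y (M *m x).
Proof. by move=> sM; rewrite dot_mulmxr sM dotC. Qed.

Lemma qformE n (M : 'M[R]_n) v : qform M v = dot v (M *m v).
Proof. by rewrite /qform /dot mulmxA. Qed.

Lemma qform1 n (v : 'cV[R]_n) : qform 1%:M v = dot v v.
Proof. by rewrite qformE mul1mx. Qed.

Lemma qformDl n (M N : 'M[R]_n) v : qform (M + N) v = qform M v + qform N v.
Proof. by rewrite !qformE mulmxDl dotDr. Qed.

Lemma qformNl n (M : 'M[R]_n) v : qform (- M) v = - qform M v.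
Proof. by rewrite !qformE mulNmx dotNr. Qed.

Lemma qformZl n a (M : 'M[R]_n) v : qform (a *: M) v = a * qform M v.
Proof. by rewrite !qformE -scalemxAl dotZr. Qed.

Lemma qformZr n a (M : 'M[R]_n) v : qform M (a *: v) = a ^+ 2 * qform M v.
Proof. by rewrite !qformE -scalemxAr !dotL mulrA expr2. Qed.

Lemma qformNr n (M : 'M[R]_n) v : qform M (- v) = qform M v.
Proof. by rewrite -scaleN1r qformZr sqrrN expr1n mul1r. Qed.

Lemma qform0r n (M : 'M[R]_n) : qform M 0 = 0.
Proof. by rewrite qformE mulmx0 dot0r. Qed.

Lemma qformDr n (M : 'M[R]_n) x y : M^T = M ->
  qform M (x + y) = qform M x + 2 * dot x (M *m y) + qform M y.
Proof.
by move=> sM; rewrite !qformE mulmxDr !dotL (dot_symm y x sM); lra.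
Qed.

Lemma qform_conj n p (M : 'M[R]_n) (S : 'M[R]_(n, p)) v :
  qform (S^T *m M *m S) v = qform M (S *m v).
Proof. by rewrite !qformE dot_mulmxl !mulmxA. Qed.

Lemma qform_gram n p (S : 'M[R]_(n, p)) v :
  qform (S^T *m S) v = dot (S *m v) (S *m v).
Proof. by rewrite qformE dot_mulmxl !mulmxA. Qed.

Lemma qform_gramT n p (S : 'M[R]_(n, p)) v :
  qform (S *m S^T) v = dot (S^T *m v) (S^T *m v).
Proof. by rewrite -qform_gram trmxK. Qed.

Lemma dot_ge0 n (x : 'cV[R]_n) : 0 <= dot x x.
Proof. by rewrite dotE; apply: sumr_ge0 => i _; rewrite -expr2 sqr_ge0. Qed.

Lemma dot_eq0 n (x : 'cV[R]_n) : dot x x = 0 -> x = 0.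
Proof.
rewrite dotE => /eqP; rewrite psumr_eq0; last first.
  by move=> i _; rewrite -expr2 sqr_ge0.
move=> /allP h; apply/matrixP => i j; rewrite ord1 mxE.
have /h : i \in index_enum 'I_n by rewrite mem_index_enum.
by rewrite /= mulf_eq0 orbb => /eqP.
Qed.

Lemma dot_gt0 n (x : 'cV[R]_n) : x != 0 -> 0 < dot x x.
Proof.
move=> x0; rewrite lt_def dot_ge0 andbT.
by apply: contra_neq x0 => /dot_eq0.
Qed.

Lemma enormE n (x : 'cV[R]_n) : enorm x = Num.sqrt (dot x x).
Proof. by rewrite /enorm dotE; under eq_bigr do rewrite expr2. Qed.

Lemma enorm_ge0 n (x : 'cV[R]_n) : 0 <= enorm x.
Proof. by rewrite enormE sqrtr_ge0. Qed.

Lemma enorm_sqr n (x : 'cV[R]_n) : enorm x ^+ 2 = dot x x.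
Proof. by rewrite enormE sqr_sqrtr ?dot_ge0. Qed.

Lemma enorm_eq0 n (x : 'cV[R]_n) : enorm x = 0 -> x = 0.
Proof. by move=> h; apply: dot_eq0; rewrite -enorm_sqr h expr0n. Qed.

Lemma enorm0 n : enorm (0 : 'cV[R]_n) = 0.
Proof. by rewrite enormE dot0r sqrtr0. Qed.

Lemma enormZ n a (x : 'cV[R]_n) : enorm (a *: x) = `|a| * enorm x.
Proof.
by rewrite !enormE !dotL mulrA -expr2 sqrtrM ?sqr_ge0// sqrtr_sqr.
Qed.

Lemma enorm_le n (x : 'cV[R]_n) c : 0 <= c -> dot x x <= c ^+ 2 -> enorm x <= c.
Proof.
by move=> c0; rewrite -enorm_sqr ler_sqr// nnegrE enorm_ge0.
Qed.

Lemma coord_le_enorm n (x : 'cV[R]_n) i : `|x i 0| <= enorm x.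
Proof.
rewrite -(@ler_sqr _ `|x i 0|) ?nnegrE ?enorm_ge0// enorm_sqr dotE.
rewrite (bigD1 i)//= -normrX ger0_norm ?sqr_ge0// expr2 lerDl.
by apply: sumr_ge0 => j _; rewrite -expr2 sqr_ge0.
Qed.

Lemma psd_cauchy_schwarz n (M : 'M[R]_n) x y : psd M ->
  dot x (M *m y) ^+ 2 <= qform M x * qform M y.
Proof.
move=> [sM pM]; have [y0|] := eqVneq (qform M y) 0.
  rewrite y0 mulr0.
  suff -> : dot x (M *m y) = 0 by rewrite expr0n.
  apply/eqP; apply: contraT => b0.
  (* This [s] makes the form at [x + s *: y] equal to -1, contradicting positivity. *)
  pose s := - (qform M x + 1) / (2 * dot x (M *m y)).
  have := pM (x + s *: y); rewrite qformDr// qformZr y0 -scalemxAr dotZr.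
  suff -> : 2 * (s * dot x (M *m y)) = - (qform M x + 1) by lra.
  by rewrite /s; field.
move=> y0; have yp : 0 < qform M y by rewrite lt_def y0 pM.
have := pM (qform M y *: x - dot x (M *m y) *: y).
rewrite qformDr// qformZr -scaleNr qformZr -scalemxAr !dotL.
set a := qform M y; set b := dot _ _; set c := qform M x => h.
have : 0 <= a * (c * a - b ^+ 2) by move: h; lra.
by rewrite pmulr_rge0// subr_ge0.
Qed.

Lemma psd1 n : psd (1%:M : 'M[R]_n).
Proof. by split; rewrite ?trmx1// => v; rewrite qform1 dot_ge0. Qed.

Lemma cauchy_schwarz n (x y : 'cV[R]_n) : dot x y <= enorm x * enorm y.
Proof.
have := psd_cauchy_schwarz x y (psd1 n); rewrite mul1mx !qform1 -!enorm_sqr.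
rewrite -exprMn => h; apply: le_trans (ler_norm _) _.
by rewrite -(@ler_sqr _ `|_|) ?nnegrE ?mulr_ge0 ?enorm_ge0// -normrX ger0_norm ?sqr_ge0.
Qed.

(** * Positive definite matrices *)

Lemma unitmx_ker n (M : 'M[R]_n) :
  (forall v : 'cV_n, M *m v = 0 -> v = 0) -> M \in unitmx.
Proof.
move=> h; rewrite -unitmx_tr -row_free_unit; apply: inj_row_free => v hv.
by apply: trmx_inj; rewrite trmx0; apply: h; rewrite -(trmxK M) -trmx_mul hv trmx0.
Qed.

Lemma trmx_invmx_sym n (M : 'M[R]_n) : M^T = M -> (invmx M)^T = invmx M.
Proof. by move=> sM; rewrite trmx_inv sM. Qed.

Lemma posdef_psd n (M : 'M[R]_n) : posdef M -> psd M.
Proof.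
move=> [sM pM]; split=> // v; have [->|/pM/ltW//] := eqVneq v 0.
by rewrite qform0r.
Qed.

Lemma posdef_unit n (M : 'M[R]_n) : posdef M -> M \in unitmx.
Proof.
move=> [sM pM]; apply: unitmx_ker => v Mv0; apply/eqP; apply: contraT => /pM.
by rewrite qformE Mv0 dot0r ltxx.
Qed.

Lemma posdef_ge n (M : 'M[R]_n) q : M^T = M -> 0 < q ->
  (forall v, q * dot v v <= qform M v) -> posdef M.
Proof.
move=> sM q0 h; split=> // v v0; apply: lt_le_trans (h v).
by rewrite mulr_gt0// dot_gt0.
Qed.

Lemma psdD n (M N : 'M[R]_n) : psd M -> psd N -> psd (M + N).
Proof.
move=> [sM pM] [sN pN]; split=> [|v]; first by rewrite linearD /= sM sN.
by rewrite qformDl addr_ge0.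
Qed.

Lemma posdefD n (M N : 'M[R]_n) : posdef M -> psd N -> posdef (M + N).
Proof.
move=> [sM pM] [sN pN]; split=> [|v v0]; first by rewrite linearD /= sM sN.
by rewrite qformDl ltr_wpDr// pM.
Qed.

Lemma psd_conj n p (M : 'M[R]_n) (S : 'M[R]_(n, p)) :
  psd M -> psd (S^T *m M *m S).
Proof.
move=> [sM pM]; split=> [|v]; last by rewrite qform_conj.
by rewrite !trmx_mul sM trmxK !mulmxA.
Qed.

Lemma psd_gram n p (S : 'M[R]_(n, p)) : psd (S^T *m S).
Proof. by have := psd_conj S (psd1 n); rewrite mulmx1. Qed.

Lemma posdefZ n (M : 'M[R]_n) c : 0 < c -> posdef M -> posdef (c *: M).
Proof.
move=> c0 [sM pM]; split=> [|v v0]; first by rewrite linearZ /= sM.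
by rewrite qformZl mulr_gt0// pM.
Qed.

Lemma qform_invmx n (M : 'M[R]_n) v : M \in unitmx -> M^T = M ->
  qform (invmx M) v = qform M (invmx M *m v).
Proof.
move=> uM sM.
by rewrite -qform_conj (trmx_invmx_sym sM) mulVmx// mul1mx.
Qed.

Lemma posdef_inv n (M : 'M[R]_n) : posdef M -> posdef (invmx M).
Proof.
move=> pM; have uM := posdef_unit pM; case: pM => [sM pM].
split=> [|v v0]; first exact: trmx_invmx_sym.
rewrite qform_invmx//; apply: pM; apply: contra_neq v0 => h.
by rewrite -[v](mulKVmx uM) h mulmx0.
Qed.

(** Expand the nonnegative form of [M] at [p - M^-1 x]. Equality holds for [x = M p]; all duality
    below is built from this inequality. *)
Lemma fenchel n (M : 'M[R]_n) (p x : 'cV[R]_n) : posdef M ->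
  2 * dot p x - qform M p <= qform (invmx M) x.
Proof.
move=> pM; have uM := posdef_unit pM; have [sM nM] := posdef_psd pM.
have := nM (p - invmx M *m x).
rewrite qformDr// mulmxN mulKVmx// !dotL.
have -> : qform M (- (invmx M *m x)) = qform (invmx M) x.
  by rewrite qformNr qform_invmx.
lra.
Qed.

Lemma fenchel_eq n (M : 'M[R]_n) (p : 'cV[R]_n) : posdef M ->
  qform (invmx M) (M *m p) = qform M p.
Proof.
move=> pM; have uM := posdef_unit pM; have [sM _] := pM.
by rewrite qform_invmx// mulKmx.
Qed.

(** Take [x = N p] in the hypothesis and bound [invmx M] from below there by [fenchel] at [k^-1 p].
    This carries the contraction from inverses back to the Riccati iterates. *)
Lemma qform_inv_antitone n (M N : 'M[R]_n) k : posdef M -> posdef N -> 0 < k ->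
  (forall x, k * qform (invmx M) x <= qform (invmx N) x) ->
  forall p : 'cV[R]_n, qform N p <= k^-1 * qform M p.
Proof.
move=> pM pN k0 h p.
have h1 := h (N *m p); rewrite fenchel_eq// in h1.
have := fenchel (k^-1 *: p) (N *m p) pM.
rewrite dotZl -qformE qformZr => h2.
have := le_trans (ler_wpM2l (ltW k0) h2) h1.
have -> : k * (2 * (k^-1 * qform N p) - k^-1 ^+ 2 * qform M p)
  = 2 * qform N p - k^-1 * qform M p by field; rewrite gt_eqF.
lra.
Qed.

Lemma qform_inv_le n (M N : 'M[R]_n) : posdef M -> posdef N ->
  (forall x, qform M x <= qform N x) ->
  forall x, qform (invmx N) x <= qform (invmx M) x.
Proof.
move=> pM pN h x; have := fenchel (invmx N *m x) x pM.
have := h (invmx N *m x); rewrite -qform_invmx ?(posdef_unit pN)//; last by case: pN.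
by rewrite dotC -qformE; lra.
Qed.

Lemma invmx_le n (M : 'M[R]_n) q : posdef M -> 0 < q ->
  (forall v, q * dot v v <= qform M v) ->
  forall v, qform (invmx M) v <= q^-1 * dot v v.
Proof.
move=> pM q0 h v.
have pq : posdef (q *: (1%:M : 'M[R]_n)).
  apply: (@posdef_ge _ _ q) => //; first by rewrite linearZ /= trmx1.
  by move=> w; rewrite qformZl qform1.
have := @qform_inv_le _ _ _ pq pM _ v; rewrite invmxZ ?invmx1; last first.
  exact: posdef_unit.
by rewrite qformZl qform1; apply=> x; rewrite qformZl qform1.
Qed.

Lemma invmx_ge n (M : 'M[R]_n) q : posdef M -> 0 < q ->
  (forall v, qform M v <= q * dot v v) ->
  forall v, q^-1 * dot v v <= qform (invmx M) v.
Proof.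
move=> pM q0 h v.
have pq : posdef (q *: (1%:M : 'M[R]_n)).
  apply: (@posdef_ge _ _ q) => //; first by rewrite linearZ /= trmx1.
  by move=> w; rewrite qformZl qform1.
have := @qform_inv_le _ _ _ pM pq _ v; rewrite invmxZ ?invmx1; last first.
  exact: posdef_unit.
by rewrite qformZl qform1; apply=> x; rewrite qformZl qform1.
Qed.

End Dot.

(** * Operator norm and least eigenvalue *)

Section Spectral.
Context {R : realType}.
Implicit Types m n : nat.

Lemma enorm_le_sum n (x : 'cV[R]_n) : enorm x <= \sum_i `|x i 0|.
Proof.
apply: enorm_le; first by apply: sumr_ge0 => i _; exact: normr_ge0.
rewrite dotE expr2 mulr_suml; apply: ler_sum => i _.
apply: le_trans (ler_norm _) _; rewrite normrM ler_wpM2l//.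
by rewrite (bigD1 i)//= lerDl; apply: sumr_ge0 => j _; exact: normr_ge0.
Qed.

Lemma enorm_mulmx_le m n (M : 'M[R]_(m, n)) v :
  enorm (M *m v) <= (\sum_i \sum_j `|M i j|) * enorm v.
Proof.
apply: le_trans (enorm_le_sum _) _; rewrite mulr_suml; apply: ler_sum => i _.
rewrite mxE; apply: le_trans (ler_norm_sum _ _ _) _.
rewrite mulr_suml; apply: ler_sum => j _.
by rewrite normrM ler_wpM2l// coord_le_enorm.
Qed.

Lemma opnorm_has_sup m n (M : 'M[R]_(m, n)) :
  has_sup [set enorm (M *m v) | v in [set v : 'cV[R]_n | enorm v <= 1]].
Proof.
split; first by exists (enorm (M *m 0)), 0 => //=; rewrite enorm0.
exists (\sum_i \sum_j `|M i j|) => _ [v /= v1 <-].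
apply: le_trans (enorm_mulmx_le _ _) _.
rewrite -[leRHS]mulr1 ler_wpM2l//.
by apply: sumr_ge0 => i _; apply: sumr_ge0 => j _; exact: normr_ge0.
Qed.

Lemma enorm_le_opnorm m n (M : 'M[R]_(m, n)) v :
  enorm (M *m v) <= opnorm M * enorm v.
Proof.
have [/enorm_eq0 ->|v0] := eqVneq (enorm v) 0; first by rewrite mulmx0 !enorm0 mulr0.
have vp : 0 < enorm v by rewrite lt_def v0 enorm_ge0.
rewrite -ler_pdivrMr//.
have := sup_upper_bound (opnorm_has_sup M); apply.
exists ((enorm v)^-1 *: v) => /=; last first.
  by rewrite -scalemxAr enormZ ger0_norm ?invr_ge0 ?enorm_ge0// mulrC.
by rewrite enormZ ger0_norm ?invr_ge0 ?enorm_ge0// mulVf.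
Qed.

Lemma opnorm_le m n (M : 'M[R]_(m, n)) c : 0 <= c ->
  (forall v, enorm (M *m v) <= c * enorm v) -> opnorm M <= c.
Proof.
move=> c0 h; apply: ge_sup; first by case: (opnorm_has_sup M).
move=> _ [v /= v1 <-]; apply: le_trans (h v) _.
by rewrite -[leRHS]mulr1 ler_wpM2l.
Qed.

Lemma opnorm_ge0 m n (M : 'M[R]_(m, n)) : 0 <= opnorm M.
Proof.
apply: le_trans (enorm_ge0 (M *m 0)) _.
by apply: sup_upper_bound (opnorm_has_sup M) _ _; exists 0 => //=; rewrite enorm0.
Qed.

Lemma coord_le_opnorm m n (M : 'M[R]_(m, n)) i j : `|M i j| <= opnorm M.
Proof.
have h : enorm (delta_mx j 0 : 'cV[R]_n) = 1.
  rewrite enormE dotE (bigD1 j)//= big1 ?addr0 => [|k kj].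
    by rewrite mxE !eqxx mulr1 sqrtr1.
  by rewrite mxE (negPf kj) mul0r.
have := enorm_le_opnorm M (delta_mx j 0); rewrite h mulr1; apply: le_trans.
by have := coord_le_enorm (M *m delta_mx j 0) i; rewrite -colE mxE.
Qed.

Lemma opnorm_le_coord m n (M : 'M[R]_(m, n)) c : 0 <= c ->
  (forall i j, `|M i j| <= c) -> opnorm M <= m%:R * (n%:R * c).
Proof.
move=> c0 h; apply: opnorm_le => [|v]; first by rewrite !mulr_ge0.
apply: le_trans (enorm_mulmx_le _ _) _; rewrite ler_wpM2r ?enorm_ge0//.
have -> : m%:R * (n%:R * c) = \sum_(i < m) \sum_(j < n) c.
  by rewrite !sumr_const !card_ord mulr_natl mulr_natl.
by apply: ler_sum => i _; apply: ler_sum.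
Qed.

Lemma qform_le_opnorm n (M : 'M[R]_n) v : qform M v <= opnorm M * dot v v.
Proof.
rewrite qformE; apply: le_trans (cauchy_schwarz _ _) _.
rewrite -enorm_sqr expr2 mulrA [leRHS]mulrC ler_wpM2l ?enorm_ge0//.
exact: enorm_le_opnorm.
Qed.

(** Cauchy-Schwarz for the form of [M], applied to [M v] and [v], bounds |M v|^4 by c |M v|^2 times
    c |v|^2. *)
Lemma psd_opnorm_le n (M : 'M[R]_n) c : psd M -> 0 <= c ->
  (forall v, qform M v <= c * dot v v) -> opnorm M <= c.
Proof.
move=> pM c0 h; apply: opnorm_le => // v.
have [->|Mv0] := eqVneq (M *m v) 0; first by rewrite enorm0 mulr_ge0 ?enorm_ge0.
apply: enorm_le; first by rewrite mulr_ge0 ?enorm_ge0.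
have := psd_cauchy_schwarz (M *m v) v pM; rewrite exprMn enorm_sqr => cs.
have h2 : qform M (M *m v) * qform M v
    <= (c * dot (M *m v) (M *m v)) * (c * dot v v).
  by apply: ler_pM => //; apply: (pM.2).
have := le_trans cs h2; have := dot_gt0 Mv0.
set s := dot (M *m v) _; set d := dot v v => s0.
have -> : c * s * (c * d) = s * (c ^+ 2 * d) by ring.
by rewrite expr2 ler_pM2l.
Qed.

(** Minimize the Rayleigh quotient over the compact unit sphere. The sphere is taken in row vectors
    to match the compactness and extreme value theorems applied. *)
Lemma min_eigenvector n (M : 'M[R]_n) : (0 < n)%N -> M^T = M ->
  exists l, exists2 v : 'cV[R]_n, v != 0 &
    M *m v = l *: v /\ forall w, l * dot w w <= qform M w.
Proof.
move=> n0 sM.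
pose S := [set r : 'rV[R]_n | dot r^T r^T = 1].
have cf (N : 'M[R]_n) : continuous (fun r : 'rV[R]_n => qform N r^T).
  have -> : (fun r : 'rV[R]_n => qform N r^T) =
      (fun r => \sum_i \sum_j r 0 i * (N i j * r 0 j)).
    apply/funext => r; rewrite qformE dotE; apply: eq_bigr => i _.
    by rewrite !mxE mulr_sumr; apply: eq_bigr => j _; rewrite !mxE.
  apply: continuous_big => [|i _]; first exact: add_continuous.
  apply: continuous_big => [|j _ r]; first exact: add_continuous.
  exact: (cvgM (@coord_continuous R 1 n 0 i r)
    (cvgM (cvg_cst (N i j)) (@coord_continuous R 1 n 0 j r))).
have S0 : S !=set0.
  exists (delta_mx 0 (Ordinal n0)); rewrite /S /= trmx_delta dotE.
  rewrite (bigD1 (Ordinal n0))//= big1 ?addr0 => [|k kj].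
    by rewrite mxE !eqxx mulr1.
  by rewrite mxE (negPf kj) mul0r.
have cS : compact S.
  apply: (@subclosed_compact _ _
    [set v : 'rV[R]_n | forall i, `[(-1 : R), 1]%classic (v ord0 i)]).
  - have -> : S = (fun r : 'rV[R]_n => qform 1%:M r^T) @^-1` [set 1].
      by apply/seteqP; split => r /=; rewrite qform1.
    apply: preimage_closed; last exact: closed_eq.
    by move=> r _; apply: cf.
  - apply: (@rV_compact _ _ (fun=> `[(-1 : R), 1]%classic)).
    by move=> _; exact: segment_compact.
  - move=> r rS i /=; rewrite in_itv /= -ler_norml.
    have := coord_le_enorm r^T i; rewrite mxE enormE.
    by move: rS; rewrite /S /= => ->; rewrite sqrtr1.
have /(EVT_min_rV S0 cS)[r rS rmin] : {within S, continuous (fun r => qform M r^T)}.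
  by apply: continuous_subspaceT; exact: cf.
have r1 : dot r^T r^T = 1 by move: rS; rewrite inE.
pose l := qform M r^T.
have hl w : l * dot w w <= qform M w.
  have [->|w0] := eqVneq w 0; first by rewrite dot0r mulr0 qform0r.
  have wp := dot_gt0 w0; have ep : 0 < enorm w by rewrite enormE sqrtr_gt0.
  have := rmin ((enorm w)^-1 *: w)^T.
  rewrite inE trmxK qformZr exprVn enorm_sqr /S /= !trmxK !dotL mulrA -expr2.
  rewrite exprVn enorm_sqr mulVf ?gt_eqF// => /(_ erefl).
  by rewrite mulrC ler_pdivlMr.
exists l, r^T.
  apply: contra_eq_neq r1 => ->; rewrite dot0r eq_sym; exact: oner_neq0.
split=> //.
(* The minimizer is a null vector of the semidefinite form of [M - l%:M]; Cauchy-Schwarz for that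
   form makes it a kernel vector. *)
have pN : psd (M - l%:M).
  split=> [|w]; first by rewrite linearB /= sM tr_scalar_mx.
  by rewrite -scalemx1 -scaleNr qformDl qformZl qform1 mulNr subr_ge0.
have : (M - l%:M) *m r^T = 0.
  apply: dot_eq0.
  have := psd_cauchy_schwarz ((M - l%:M) *m r^T) r^T pN.
  have -> : qform (M - l%:M) r^T = 0.
    by rewrite -scalemx1 -scaleNr qformDl qformZl qform1 r1 mulr1 subrr.
  rewrite mulr0 => h; apply/eqP; rewrite -sqrf_eq0.
  by rewrite eq_le h sqr_ge0.
by rewrite mulmxBl mul_scalar_mx => /subr0_eq.
Qed.

(** The minimum of the Rayleigh quotient is an eigenvalue and a lower bound for all of them, so the
    infimum defining [lambda_min] is attained. *)
Lemma lambda_minP n (M : 'M[R]_n) : (0 < n)%N -> M^T = M ->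
  exists2 v : 'cV[R]_n, v != 0 & M *m v = lambda_min M *: v.
Proof.
move=> n0 sM; have [l [v v0 [Mv hl]]] := min_eigenvector n0 sM.
suff -> : lambda_min M = l by exists v.
have el : eigenvalue M l.
  apply/eigenvalueP; exists v^T; last by rewrite -trmx0 (inj_eq trmx_inj).
  by rewrite -{1}sM -trmx_mul Mv linearZ.
have lb : lbound [set a : R | eigenvalue M a] l.
  move=> a /= /eigenvalueP[w wM w0].
  have := hl w^T; rewrite qformE -{1}sM -trmx_mul wM linearZ /= dotZr.
  by rewrite ler_pM2r// dot_gt0// -trmx0 (inj_eq trmx_inj).
apply/eqP; rewrite eq_le; apply/andP; split.
  by apply: ge_inf => //; exists l.
by apply: lb_le_inf => //; exists l.
Qed.

Lemma lambda_min_le n (M : 'M[R]_n) (w : 'cV[R]_n) : (0 < n)%N -> M^T = M ->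
  lambda_min M * dot w w <= qform M w.
Proof.
move=> n0 sM; have [l [v v0 [Mv hl]]] := min_eigenvector n0 sM.
suff : lambda_min M <= l.
  by move=> h; apply: le_trans (hl w); rewrite ler_wpM2r ?dot_ge0.
apply: ge_inf.
  exists l => a /= /eigenvalueP[u uM u0].
  have := hl u^T; rewrite qformE -{1}sM -trmx_mul uM linearZ /= dotZr.
  by rewrite ler_pM2r// dot_gt0// -trmx0 (inj_eq trmx_inj).
apply/eigenvalueP; exists v^T; last by rewrite -trmx0 (inj_eq trmx_inj).
by rewrite -{1}sM -trmx_mul Mv linearZ.
Qed.

Lemma le_lambda_min n (M : 'M[R]_n) c : (0 < n)%N -> M^T = M ->
  (forall w, c * dot w w <= qform M w) -> c <= lambda_min M.
Proof.
move=> n0 sM h; have [v v0 Mv] := lambda_minP n0 sM.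
by have := h v; rewrite qformE Mv dotZr ler_pM2r// dot_gt0.
Qed.

Lemma lambda_min_le_opnorm n (M N : 'M[R]_n) : (0 < n)%N -> M^T = M ->
  (forall w, qform M w <= qform N w) -> lambda_min M <= opnorm N.
Proof.
move=> n0 sM h; have [v v0 Mv] := lambda_minP n0 sM.
have := le_trans (h v) (qform_le_opnorm N v).
by rewrite qformE Mv dotZr ler_pM2r// dot_gt0.
Qed.

(** With w = M^-1 v: q |w|^2 <= w' M w = w' v <= |w| |v|. *)
Lemma enorm_invmx_le n (M : 'M[R]_n) q v : M \in unitmx -> 0 < q ->
  (forall v, q * dot v v <= qform M v) -> enorm (invmx M *m v) <= q^-1 * enorm v.
Proof.
move=> uM q0 h; have := h (invmx M *m v).
rewrite qformE mulKVmx// => h1.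
have := le_trans h1 (cauchy_schwarz _ _); rewrite -enorm_sqr.
have [->|w0] := eqVneq (enorm (invmx M *m v)) 0.
  by move=> _; rewrite mulr_ge0 ?enorm_ge0 ?invr_ge0 ?ltW.
have wp : 0 < enorm (invmx M *m v) by rewrite lt_def w0 enorm_ge0.
rewrite expr2 mulrCA ler_pM2l// => h2.
by rewrite mulrC ler_pdivlMr// mulrC.
Qed.

End Spectral.

(** * One step of the Riccati recursion *)

(** For [T = A^-1 B] the left side is the matrix whose norm is [zeta], and the term subtracted on
    the right is the one whose least eigenvalue is [epsilon]. *)
Lemma woodbury (R : realType) n p (Q : 'M[R]_n) (W : 'M[R]_p) (T : 'M[R]_(n, p)) :
  posdef Q -> posdef W ->
  invmx (Q + Q *m T *m invmx W *m T^T *m Q)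
  = invmx Q - T *m invmx (W + T^T *m Q *m T) *m T^T.
Proof.
move=> pQ pW; have uQ := posdef_unit pQ; have uW := posdef_unit pW.
have uH : W + T^T *m Q *m T \in unitmx.
  by apply: posdef_unit; apply: posdefD => //; apply: psd_conj; exact: posdef_psd.
set H := W + _ in uH *.
have pV : posdef (Q + Q *m T *m invmx W *m T^T *m Q).
  apply: posdefD => //.
  have -> : Q *m T *m invmx W *m T^T *m Q = (T^T *m Q)^T *m invmx W *m (T^T *m Q).
    by rewrite trmx_mul trmxK pQ.1 !mulmxA.
  by apply: psd_conj; apply: posdef_psd; exact: posdef_inv.
have uV := posdef_unit pV; set V := Q + _ in pV uV *.
suff VI : V *m (invmx Q - T *m invmx H *m T^T) = 1%:M.
  by rewrite -[RHS](mulKmx uV) VI mulmx1.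
rewrite mulmxBr mulmxDl mulmxV// -[_ *m Q *m invmx Q]mulmxA mulmxV// mulmx1.
apply/eqP; rewrite -addrA addrC -subr_eq0 addrK; apply/eqP.
rewrite /V mulmxDl.
have e : Q *m T *m invmx W *m H = Q *m T + Q *m T *m invmx W *m T^T *m Q *m T.
  rewrite /H mulmxDr -[_ *m invmx W *m W]mulmxA mulVmx// mulmx1.
  by congr (_ + _); rewrite !mulmxA.
have -> : Q *m (T *m invmx H *m T^T)
    + Q *m T *m invmx W *m T^T *m Q *m (T *m invmx H *m T^T)
   = (Q *m T + Q *m T *m invmx W *m T^T *m Q *m T) *m (invmx H *m T^T).
  by rewrite mulmxDl !mulmxA.
by rewrite -e -[_ *m H *m _]mulmxA mulKVmx// subrr.
Qed.

Section RiccatiStep.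
Context {R : realType} {n p : nat} (L : lq_data R n p) (t : nat).

Local Notation A := (lqA L t).
Local Notation B := (lqB L t).
Local Notation Q := (lqQ L t).
Local Notation W := (lqR L t).

Definition input_hessian (Y : 'M[R]_n) : 'M[R]_p := W + B^T *m Y *m B.

Definition gain (Y : 'M[R]_n) : 'M[R]_(p, n) :=
  invmx (input_hessian Y) *m B^T *m Y *m A.

Hypothesis pQ : psd Q.
Hypothesis pW : posdef W.

Lemma posdef_input_hessian Y : psd Y -> posdef (input_hessian Y).
Proof. by move=> pY; apply: posdefD => //; exact: psd_conj. Qed.

Lemma input_hessian_gain Y : psd Y -> input_hessian Y *m gain Y = B^T *m Y *m A.
Proof.
move=> pY; have uH := posdef_unit (posdef_input_hessian pY).
by rewrite /gain -!mulmxA mulKVmx.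
Qed.

Lemma riccati_costate Y : riccati L t Y = Q + A^T *m Y *m (A - B *m gain Y).
Proof.
rewrite /riccati /gain /input_hessian; congr (_ + _).
by rewrite mulmxBr mulmxBl mulmxBr !mulmxA.
Qed.

(** First-order optimality of the input u = - K x: W u + B' Y (A x + B u) = 0. *)
Lemma gain_stationary Y : psd Y ->
  W *m gain Y = B^T *m Y *m (A - B *m gain Y).
Proof.
move=> pY; have := input_hessian_gain pY.
rewrite /input_hessian mulmxDl mulmxBr !mulmxA => <-.
by rewrite addrK.
Qed.

(** Identifies [riccati] as the partial minimum over u of one-step cost plus terminal weight;
    monotonicity, the lower bound by Q and the deadbeat comparison all follow from it. *)
Lemma cost_complete_square Y x u : psd Y ->
  stage_cost L t x u + qform Y (A *m x + B *m u)
  = qform (riccati L t Y) x + qform (input_hessian Y) (u + gain Y *m x).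
Proof.
move=> pY; have [sY _] := pY; have pH := posdef_input_hessian pY.
have [sH _] := pH.
have cross w : dot w (B^T *m Y *m A *m x) = dot (A *m x) (Y *m (B *m w)).
  by rewrite -!mulmxA dot_mulmxr trmxK dot_symm.
have -> : qform (riccati L t Y) x
    = qform Q x + qform Y (A *m x) - dot (A *m x) (Y *m (B *m (gain Y *m x))).
  rewrite riccati_costate qformDl -addrA; congr (_ + _).
  rewrite mulmxBr !qformE mulmxBl dotDr dotNr -!mulmxA.
  by rewrite 2![dot x (A^T *m _)]dot_mulmxr !trmxK.
rewrite /stage_cost !qformDr// (mulmxA (input_hessian Y)) input_hessian_gain// cross.
rewrite [qform _ (gain Y *m x)]qformE (mulmxA (input_hessian Y)) input_hessian_gain// cross.
by rewrite {1}/input_hessian qformDl qform_conj; lra.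
Qed.

Lemma riccati_le_cost Y x u : psd Y ->
  qform (riccati L t Y) x <= stage_cost L t x u + qform Y (A *m x + B *m u).
Proof.
move=> pY; rewrite cost_complete_square// lerDl.
by apply: (posdef_psd (posdef_input_hessian pY)).2.
Qed.

Lemma riccati_gain_cost Y x : psd Y ->
  qform (riccati L t Y) x
  = stage_cost L t x (- (gain Y *m x)) + qform Y ((A - B *m gain Y) *m x).
Proof.
move=> pY; have := cost_complete_square x (- (gain Y *m x)) pY.
by rewrite addNr qform0r addr0 mulmxBl mulmxN mulmxA => ->.
Qed.

Lemma stage_cost_ge0 x u : 0 <= stage_cost L t x u.
Proof. by rewrite addr_ge0 ?pQ.2// (posdef_psd pW).2. Qed.

Lemma riccati_ge_Q Y x : psd Y -> qform Q x <= qform (riccati L t Y) x.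
Proof.
move=> pY; rewrite riccati_gain_cost// /stage_cost -addrA lerDl.
by rewrite addr_ge0 ?pY.2// (posdef_psd pW).2.
Qed.

Lemma riccati_psd Y : psd Y -> psd (riccati L t Y).
Proof.
move=> pY; split=> [|v]; last by apply: le_trans (riccati_ge_Q v pY); exact: pQ.2.
have [sH _] := posdef_input_hessian pY; have [sY _] := pY.
rewrite /riccati linearD /= pQ.1; congr (_ + _).
rewrite !trmx_mul trmxK linearB /= !trmx_mul trmxK sY.
by rewrite (trmx_invmx_sym sH) !mulmxA.
Qed.

Lemma riccati_mono Y Z : psd Y -> psd Z -> (forall x, qform Y x <= qform Z x) ->
  forall x, qform (riccati L t Y) x <= qform (riccati L t Z) x.
Proof.
move=> pY pZ h x; rewrite (riccati_gain_cost x pZ).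
apply: le_trans (riccati_le_cost x (- (gain Z *m x)) pY) _.
by rewrite lerD2l mulmxBl mulmxN mulmxA.
Qed.

Lemma gain_weight_le Y x : psd Y ->
  qform (Q + (gain Y)^T *m W *m gain Y) x <= qform (riccati L t Y) x.
Proof.
move=> pY; rewrite riccati_gain_cost// /stage_cost qformDl qform_conj.
by rewrite qformNr lerDl pY.2.
Qed.

(** * The one-step deadbeat input and the terminal penalty *)

Section Deadbeat.
Hypothesis uBB : B *m B^T \in unitmx.

(** B' (B B')^-1 is the Moore-Penrose right inverse of B, so this is the least-norm input sending
    [x] to 0. *)
Definition deadbeat (x : 'cV[R]_n) : 'cV[R]_p :=
  - (B^T *m invmx (B *m B^T) *m A *m x).

Lemma deadbeat_next x : A *m x + B *m deadbeat x = 0.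
Proof.
by rewrite /deadbeat mulmxN !mulmxA mulmxV// mul1mx subrr.
Qed.

Lemma qform_terminal_penalty x :
  qform (terminal_penalty L t) x = stage_cost L t x (deadbeat x).
Proof.
have sG : (invmx (B *m B^T))^T = invmx (B *m B^T).
  by apply: trmx_invmx_sym; rewrite trmx_mul trmxK.
rewrite /terminal_penalty /stage_cost qformDl; congr (_ + _).
rewrite /deadbeat qformNr -qform_conj; congr (qform _ _).
by rewrite !trmx_mul trmxK sG !mulmxA.
Qed.

(** The deadbeat input annihilates the terminal term, so the bound is uniform in [Y]: for Y =
    X_(t+1) it is the decrease condition on the penalties, and for the receding-horizon weights it
    bounds [omega_up]. *)
Lemma riccati_le_terminal_penalty Y x : psd Y ->
  qform (riccati L t Y) x <= qform (terminal_penalty L t) x.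
Proof.
move=> pY; rewrite qform_terminal_penalty.
by have := riccati_le_cost x (deadbeat x) pY; rewrite deadbeat_next qform0r addr0.
Qed.

Lemma terminal_penalty_psd : psd (terminal_penalty L t).
Proof.
split=> [|v]; last by rewrite qform_terminal_penalty stage_cost_ge0.
have sG : (invmx (B *m B^T))^T = invmx (B *m B^T).
  by apply: trmx_invmx_sym; rewrite trmx_mul trmxK.
by rewrite /terminal_penalty linearD /= !trmx_mul !trmxK sG pQ.1 pW.1 !mulmxA.
Qed.

(* If driving the state to zero were optimal, its input would satisfy the
   stationarity condition [W u = - B' Y (A x + B u) = 0]. *)
Lemma riccati_lt_terminal_penalty Y x : A \in unitmx -> psd Y -> x != 0 ->
  qform (riccati L t Y) x < qform (terminal_penalty L t) x.
Proof.
move=> uA pY; apply: contra_neqT; rewrite -leNgt qform_terminal_penalty => h.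
have := cost_complete_square x (deadbeat x) pY.
rewrite deadbeat_next qform0r addr0 => e.
have pH := posdef_input_hessian pY.
have /eqP z : deadbeat x + gain Y *m x == 0.
  apply: contraT => /pH.2; rewrite e in h; lra.
have := deadbeat_next x; have -> : deadbeat x = 0.
  have : input_hessian Y *m (deadbeat x + gain Y *m x) = W *m deadbeat x.
    rewrite mulmxDr (mulmxA (input_hessian Y)) input_hessian_gain// /input_hessian.
    rewrite mulmxDl -addrA -mulmxA -[_ *m A *m x]mulmxA -mulmxDr addrC.
    by rewrite [_ + A *m x]addrC deadbeat_next mulmx0 add0r.
  rewrite z mulmx0 => /esym h0.
  by rewrite -[deadbeat x](mulKmx (posdef_unit pW)) h0 mulmx0.
rewrite mulmx0 addr0 => Ax.
by rewrite -[x](mulKmx uA) Ax mulmx0.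
Qed.

End Deadbeat.

(** * Contraction of the Riccati operator *)

Section Contraction.
Hypothesis pdQ : posdef Q.
Hypothesis uA : A \in unitmx.

Local Notation T := (invmx A *m B).
Local Notation E := (T *m invmx (W + T^T *m Q *m T) *m T^T).

Lemma riccati_posdef Y : psd Y -> posdef (riccati L t Y).
Proof.
move=> pY; split=> [|v v0]; first by case: (riccati_psd pY).
by apply: lt_le_trans (riccati_ge_Q v pY); exact: pdQ.2.
Qed.

(* Lagrangian dual of one step of the problem with terminal weight [Y], with
   multiplier [z] and [a *: invmx Y] in place of [invmx Y]. *)
Definition dual_cost (a : R) (Y : 'M[R]_n) (x z : 'cV[R]_n) : R :=
  qform (invmx Q) (x - A^T *m z) + a * qform (invmx Y) z
  + qform (invmx W) (B^T *m z).

(** Weak duality: [fenchel] for Q at v, Y at A v - B u and W at u; in the sum of the three pairings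
    everything involving z cancels, leaving v' x. *)
Lemma riccati_inv_le_dual Y x z : posdef Y ->
  qform (invmx (riccati L t Y)) x <= dual_cost 1 Y x z.
Proof.
move=> pY; have pY' := posdef_psd pY.
have pM := riccati_posdef pY'; have uM := posdef_unit pM.
pose v := invmx (riccati L t Y) *m x; pose u := gain Y *m v.
pose s := A *m v - B *m u.
have e1 : qform (invmx (riccati L t Y)) x = 2 * dot v x - qform (riccati L t Y) v.
  have eq1 := qform_invmx x uM pM.1; rewrite -/v in eq1.
  have : dot v x = qform (riccati L t Y) v by rewrite qformE mulKVmx.
  rewrite eq1 => ->; lra.
have e2 : qform (riccati L t Y) v = qform Q v + qform W u + qform Y s.
  rewrite riccati_gain_cost// /stage_cost qformNr.
  by rewrite mulmxBl -(mulmxA B).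
have f1 := fenchel v (x - A^T *m z) pdQ.
have f2 := fenchel s z pY.
have f3 := fenchel u (B^T *m z) pW.
rewrite dotDr dotNr (dot_mulmxr A^T) (dot_mulmxr B^T) !trmxK in f1 f3.
rewrite {1}/s !dotL in f2.
rewrite e1 e2 /dual_cost mul1r; lra.
Qed.

(** There is no duality gap: some multiplier makes all three [fenchel] inequalities tight. *)
Lemma riccati_inv_eq_dual Y x c : posdef Y -> 0 < c ->
  exists z, qform (invmx (riccati L t (c *: Y))) x = dual_cost c^-1 Y x z.
Proof.
move=> pY c0; have pcY := posdefZ c0 pY; have pcY' := posdef_psd pcY.
have pM := riccati_posdef pcY'; have uM := posdef_unit pM.
set M := riccati _ _ _ in pM uM *; pose v := invmx M *m x.
pose K := gain (c *: Y); pose s := (A - B *m K) *m v.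
(* The multiplier is the costate, that is the terminal weight applied to the optimal next state. *)
exists ((c *: Y) *m s); rewrite /dual_cost.
have -> : x - A^T *m (c *: Y *m s) = Q *m v.
  rewrite -[x](mulKVmx uM) -/v /M riccati_costate mulmxDl -/K /s !mulmxA.
  by rewrite addrK.
have -> : B^T *m (c *: Y *m s) = W *m (K *m v).
  by rewrite (mulmxA W) /K gain_stationary// /s !mulmxA.
rewrite !fenchel_eq// -scalemxAl qformZr fenchel_eq//.
rewrite qform_invmx//; last exact: pM.1.
rewrite -/v /M riccati_gain_cost// /stage_cost -/K -/s qformNr.
rewrite qformZl.
have -> : c^-1 * (c ^+ 2 * qform Y s) = c * qform Y s by field; rewrite gt_eqF.
ring.
Qed.

(** Weak duality again, with the terminal term dropped and primal point (T g, g); g is chosen so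
    that the primal value is exactly the form of [E]. *)
Lemma qform_E_le_dual Y x z : qform E x <= dual_cost 0 Y x z.
Proof.
have pH : posdef (W + T^T *m Q *m T).
  by apply: posdefD => //; apply: psd_conj; exact: posdef_psd.
pose g := invmx (W + T^T *m Q *m T) *m (T^T *m x).
have e1 : qform E x = dot g (T^T *m x).
  by rewrite qformE -(mulmxA (T *m _)) -(mulmxA T) (dot_mulmxr T) dotC.
have e2 : dot g (T^T *m x) = qform W g + qform Q (T *m g).
  by rewrite -(qform_conj Q T g) -qformDl qformE mulKVmx// posdef_unit.
have f1 := fenchel (T *m g) (x - A^T *m z) pdQ.
have f2 := fenchel g (B^T *m z) pW.
have e3 : dot g (B^T *m z) = dot (T *m g) (A^T *m z).
  rewrite (dot_mulmxl T) mulmxA trmx_mul trmx_inv -(mulmxA B^T) mulVmx ?mulmx1//.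
  by rewrite unitmx_tr.
have e4 : dot (T *m g) x = dot g (T^T *m x) by rewrite dot_mulmxl.
rewrite dotDr dotNr in f1.
rewrite /dual_cost mul0r addr0 e1; move: f1 f2; rewrite e3 e4; lra.
Qed.

Lemma riccati_inv_sub_le Y x : posdef Y ->
  qform (invmx (riccati L t Y)) x - qform E x
  <= qform (invmx (Q + Q *m T *m invmx W *m T^T *m Q)) x.
Proof.
move=> pY; have pY' := posdef_psd pY; rewrite woodbury// qformDl qformNl lerD2r.
apply: qform_inv_le => //; first exact: riccati_posdef.
by move=> y; exact: riccati_ge_Q.
Qed.

(** Convexity of the exponential between 0 and -s: the values at both ends lie above the tangent at
    [m], their weighted mean abscissa. *)
Lemma expR_weighted (r s : R) : 0 <= r <= 1 ->
  expR (- (r * s)) <= (1 - r) + r * expR (- s).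
Proof.
move=> /andP[r0 r1]; set m := - (r * s).
have h1 : expR m * (1 - m) <= 1.
  have := expR_ge1Dx (- m); rewrite -(ler_pM2l (expR_gt0 m)) -expRD subrr expR0.
  by [].
have h2 : expR m * (1 + (- s - m)) <= expR (- s).
  have := expR_ge1Dx (- s - m); rewrite -(ler_pM2l (expR_gt0 m)) -expRD.
  by have -> : m + (- s - m) = - s by ring.
have h3 : (1 - r) * (expR m * (1 - m)) <= 1 - r by rewrite ler_piMr ?subr_ge0.
have h4 := ler_wpM2l r0 h2.
have : expR m = (1 - r) * (expR m * (1 - m)) + r * (expR m * (1 + (- s - m))).
  rewrite /m; ring.
by move=> ->; lra.
Qed.

Lemma riccati_contraction Y Z s z e : psd Y -> posdef Z -> 0 <= s ->
  0 <= z -> 0 < e ->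
  (forall x, qform (invmx (Q + Q *m T *m invmx W *m T^T *m Q)) x <= z * dot x x) ->
  (forall x, e * dot x x <= qform E x) ->
  (forall x, qform Y x <= expR s * qform Z x) ->
  forall x, qform (riccati L t Y) x
    <= expR (z / (z + e) * s) * qform (riccati L t Z) x.
Proof.
move=> pY pZ s0 z0 e0 hz he h x.
set r := z / (z + e).
have ze : 0 < z + e by lra.
have r01 : 0 <= r <= 1.
  by rewrite divr_ge0 ?(ltW ze)//= ler_pdivrMr// mul1r lerDl ltW.
have pcZ := posdefZ (expR_gt0 s) pZ.
(* By monotonicity it suffices to treat the extreme case Y = e^s Z; the comparison is then made
   between inverses. *)
apply: (@le_trans _ _ (qform (riccati L t (expR s *: Z)) x)).
  by apply: riccati_mono => //; [exact: posdef_psd|move=> y; rewrite qformZl].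
rewrite -[expR (r * s)]invrK -expRN.
apply: qform_inv_antitone; rewrite ?expR_gt0//.
- by apply: riccati_posdef; exact: posdef_psd.
- by apply: riccati_posdef; exact: posdef_psd.
move=> {}x; have [w ->] := riccati_inv_eq_dual x pZ (expR_gt0 s).
have k1 := expR_weighted s r01; have h1 := riccati_inv_le_dual x w pZ.
have h0 := qform_E_le_dual Z x w.
have hm := le_trans (riccati_inv_sub_le x pZ) (hz x).
have hE := he x; have d0 := dot_ge0 x.
rewrite -expRN; have c0 := expR_gt0 (- s).
have c1 : expR (- s) <= 1 by rewrite -expR0 ler_expR; lra.
set c := expR (- s) in k1 c0 c1 *; set k := expR _ in k1 *.
set a := qform (invmx _) x in h1 hm *; set b := qform E x in h0 hm hE.
set d := dot x x in hm hE d0.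
(* For a fixed multiplier the dual cost is affine in its first argument, so weight c interpolates
   between 1 (bounded below by [a]) and 0 (bounded below by [b]). *)
have -> : dual_cost c Z x w = c * dual_cost 1 Z x w + (1 - c) * dual_cost 0 Z x w.
  rewrite /dual_cost; ring.
apply: (@le_trans _ _ (c * a + (1 - c) * b)); last first.
  by apply: lerD; rewrite ler_wpM2l//; lra.
(* It remains to show (k - c) a <= (1 - c) b. As a <= b + z d and e d <= b, one has e a <= (z + e)
   b; this is why the rate is z / (z + e). *)
have kc : k - c <= (1 - c) * (e / (z + e)).
  have -> : e / (z + e) = 1 - r by rewrite /r; field; rewrite gt_eqF.
  lra.
have a0 : 0 <= a.
  by apply: (posdef_psd (posdef_inv (riccati_posdef (posdef_psd pZ)))).2.
suff : (k - c) * a <= (1 - c) * b by lra.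
apply: le_trans (ler_wpM2r a0 kc) _; rewrite -mulrA ler_wpM2l//; first lra.
rewrite mulrAC ler_pdivrMr//.
have : e * a <= e * (b + z * d) by rewrite ler_pM2l//; lra.
have : z * (e * d) <= z * b by rewrite ler_wpM2l.
lra.
Qed.

End Contraction.

End RiccatiStep.

(** * Determinants *)

(** In the Leibniz expansion a nonzero term needs f i <= g (s i) for all i. The two level sums
    agree, so these are equalities: only entries at equal levels enter the determinant. *)
Lemma det_level (F : comNzRingType) (k : nat) (f g : 'I_k -> nat) (M N : 'M[F]_k) :
  (\sum_i f i = \sum_i g i)%N ->
  (forall i j, M i j != 0 -> (f i <= g j)%N) ->
  (forall i j, N i j != 0 -> (f i <= g j)%N) ->
  (forall i j, f i = g j -> M i j = N i j) ->
  \det M = \det N.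
Proof.
move=> sfg hM hN hMN; apply: eq_bigr => s _; congr (_ * _).
have [/forallP h|] := boolP [forall i, f i <= g (s i)]%N; last first.
  rewrite negb_forall => /existsP[i]; rewrite -ltnNge => lt.
  rewrite (bigD1 i)//= [RHS](bigD1 i)//=.
  have -> : M i (s i) = 0.
    by apply/eqP; apply: contraLR lt => /hM; rewrite -leqNgt.
  have -> : N i (s i) = 0.
    by apply/eqP; apply: contraLR lt => /hN; rewrite -leqNgt.
  by rewrite !mul0r.
apply: eq_bigr => i _; apply: hMN.
have [_] := @leqif_sum _ xpredT (fun i => f i == g (s i)) f (fun i => g (s i))
  (fun i _ => leqif_eq (h i)).
have -> : (\sum_i g (s i) = \sum_i f i)%N.
  by rewrite sfg [RHS](reindex_inj (@perm_inj _ s)).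
by rewrite eqxx => /esym /forallP /(_ i) /= /eqP.
Qed.

Lemma det_schur (F : fieldType) (k l : nat) (M : 'M[F]_k) (b : 'M[F]_(k, l))
    (c : 'M[F]_(l, k)) : M \in unitmx ->
  \det (block_mx M b c 0) = \det M * \det (- (c *m invmx M *m b)).
Proof.
move=> uM.
have -> : block_mx M b c 0 = block_mx 1%:M 0 (c *m invmx M) 1%:M
    *m block_mx M b 0 (- (c *m invmx M *m b)).
  rewrite mulmx_block !mul1mx !mul0mx !addr0 mulmxKV//.
  by rewrite subrr.
by rewrite det_mulmx det_lblock det_ublock !det1 !mul1r.
Qed.

Lemma det_sylvester (F : comNzRingType) (k l : nat) (X : 'M[F]_(k, l))
    (Y : 'M[F]_(l, k)) : \det (1%:M + X *m Y) = \det (1%:M + Y *m X).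
Proof.
have e1 : block_mx 1%:M (- X) Y 1%:M =
    block_mx 1%:M 0 Y 1%:M *m block_mx 1%:M (- X) 0 (1%:M + Y *m X).
  rewrite mulmx_block ?(mul1mx, mul0mx, mulmx0, mulmx1) !addr0.
  by rewrite mulmxN addrCA addNr addr0.
have e2 : block_mx 1%:M (- X) Y 1%:M =
    block_mx (1%:M + X *m Y) (- X) 0 1%:M *m block_mx 1%:M 0 Y 1%:M.
  rewrite mulmx_block ?(mul1mx, mul0mx, mulmx0, mulmx1) !add0r mulNmx.
  by rewrite addrK.
have := congr1 (fun M => \det M) e1; rewrite e2 !det_mulmx !det_lblock !det_ublock.
by rewrite !det1 !(mul1r, mulr1).
Qed.

(** Add the rows of [S] one at a time: each is a rank-one update, which by Sylvester's identity
    multiplies the determinant by 1 plus a nonnegative form. *)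
Lemma det_add_gram (R : realType) (k p : nat) (W : 'M[R]_p) (S : 'M[R]_(k, p)) :
  posdef W -> exists2 c, 1 <= c & \det (W + S^T *m S) = c * \det W.
Proof.
move=> pW; elim: k S => [|k IH] S.
  by exists 1 => //; rewrite (flatmx0 S) mulmx0 addr0 mul1r.
have [c c1 hc] := IH (dsubmx (S : 'M[R]_(1 + k, p))).
set S1 := dsubmx _ in hc; pose u := usubmx (S : 'M[R]_(1 + k, p)).
have eS : S = col_mx u S1 by rewrite vsubmxK.
have eg : S^T *m S = u^T *m u + S1^T *m S1.
  by rewrite eS (@tr_col_mx _ 1 k p); exact: (@mul_row_col _ p 1 k p u^T S1^T u S1).
have pW1 : posdef (W + S1^T *m S1) by apply: posdefD => //; exact: psd_gram.
have uW1 := posdef_unit pW1.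
exists ((1 + qform (invmx (W + S1^T *m S1)) u^T) * c).
  apply: (le_trans c1); rewrite ler_peMl ?(le_trans ler01 c1)//.
  by rewrite lerDl (posdef_psd (posdef_inv pW1)).2.
rewrite -mulrA -hc eg addrCA [_ + (W + _)]addrC.
have -> : W + S1^T *m S1 + u^T *m u =
    (W + S1^T *m S1) *m (1%:M + (invmx (W + S1^T *m S1) *m u^T) *m u).
  by rewrite mulmxDr mulmx1 -(mulmxA (invmx _)) mulKVmx.
rewrite det_mulmx mulrC det_sylvester; congr (_ * _).
by rewrite det_mx11 /qform trmxK -mulmxA mxE [X in X + _]mxE eqxx.
Qed.

(** * Sparsity patterns of matrices relative to block levels *)

Section Support.
Context {F : fieldType}.

(** Block triangular, block diagonal and shifted patterns become instances of one predicate, and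
    patterns of products follow by composing relations. *)
Definition supported (k l : nat) (r : rel nat) (f : 'I_k -> nat) (g : 'I_l -> nat)
  (M : 'M[F]_(k, l)) := forall i j, M i j != 0 -> r (f i) (g j).

Lemma supported_mul k l m (r1 r2 r3 : rel nat) f g h
    (M : 'M[F]_(k, l)) (N : 'M[F]_(l, m)) :
  (forall a b c, r1 a b -> r2 b c -> r3 a c) ->
  supported r1 f g M -> supported r2 g h N -> supported r3 f h (M *m N).
Proof.
move=> r123 hM hN i j; rewrite mxE; apply: contra_neqT => nr.
rewrite big1// => a _; apply/eqP; apply: contraNT nr.
by rewrite mulf_eq0 negb_or => /andP[/hM h1 /hN h2]; exact: r123 h1 h2.
Qed.

Lemma supported_tr k l (r : rel nat) (f : 'I_k -> nat) (g : 'I_l -> nat)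
    (M : 'M[F]_(k, l)) :
  supported r f g M -> supported (fun a b => r b a) g f M^T.
Proof. by move=> h i j; rewrite mxE; exact: h. Qed.

(** From Y = 1 + N Y, a nonzero off-diagonal entry (i, j) of Y comes from a nonzero (a, j) with a of
    strictly lower level than i; induct on the level of i. *)
Lemma supported_inv_lower k (f : 'I_k -> nat) (N : 'M[F]_k) :
  1%:M - N \in unitmx -> supported (fun a b => (b < a)%N) f f N ->
  supported (fun a b => (b <= a)%N) f f (invmx (1%:M - N)).
Proof.
move=> uN hN i j; set Y := invmx _.
have eY : Y = 1%:M + N *m Y.
  have := mulmxV uN; rewrite -/Y mulmxBl mul1mx => <-.
  by rewrite addrNK.
have [s] := ubnP (f i); elim: s i => // s IH i /ltnSE fis.
rewrite eY !mxE; case: (eqVneq i j) => [->//|ij].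
rewrite add0r => h.
have [a] : exists a, N i a * Y a j != 0.
  apply/existsP; apply: contraNT h; rewrite negb_exists => /forallP h.
  by rewrite big1// => a _; have := h a; rewrite negbK => /eqP.
rewrite mulf_eq0 negb_or => /andP[/hN lt Ya].
exact: leq_trans (IH _ (leq_trans lt fis) Ya) (ltnW lt).
Qed.

End Support.

(* A matrix is block diagonal iff it commutes with the diagonal matrix of
   levels, and commutation passes to the inverse. *)
Lemma supported_inv_diag (R : realType) k (f : 'I_k -> nat) (M : 'M[R]_k) :
  M \in unitmx -> supported (fun a b => a == b) f f M ->
  supported (fun a b => a == b) f f (invmx M).
Proof.
move=> uM hM i j; pose E : 'M[R]_k := diag_mx (\row_a (f a)%:R).
have cM : M *m E = E *m M.
  apply/matrixP => a b; rewrite mul_mx_diag mul_diag_mx !mxE.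
  have [->|/hM/eqP ->] := eqVneq (M a b) 0; last by rewrite mulrC.
  by rewrite mul0r mulr0.
have : invmx M *m E = E *m invmx M.
  by rewrite -[LHS](mulmxK uM) -(mulmxA _ E) -cM mulKmx.
move=> /matrixP/(_ i j); rewrite mul_mx_diag mul_diag_mx !mxE mulrC => h n0.
by have /eqP := mulIf n0 h; rewrite eqr_nat eq_sym.
Qed.

Definition block_level (k : nat) (s : 'I_k -> nat) (i : 'I_(\sum_(j < k) s j)) : nat :=
  tagnat.sig1 i.

Lemma posdef_mxdiag (R : realType) k (s : 'I_k -> nat) (M : forall i, 'M[R]_(s i)) :
  (forall i, posdef (M i)) -> posdef (\mxdiag_i M i).
Proof.
move=> pM; split=> [|v v0].
  by rewrite tr_mxdiag; apply: eq_mxdiag => i; exact: (pM i).1.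
have -> : qform (\mxdiag_i M i) v = \sum_i qform (M i) (submxcol v i).
  rewrite qformE /dot -{1 2}(submxcolK v) mul_mxdiag_mxcol tr_mxcol mul_mxrow_mxcol.
  by rewrite summxE; apply: eq_bigr => i _; rewrite qformE.
have [i vi0] : exists i, submxcol v i != 0.
  apply/existsP; apply: contraNT v0; rewrite negb_exists => /forallP h.
  rewrite -(submxcolK v); apply/eqP/matrixP => a b; rewrite !mxE.
  by have := h (tagnat.sig1 a); rewrite negbK => /eqP/matrixP/(_ (tagnat.sig2 a) b); rewrite !mxE.
rewrite (bigD1 i)//= ltr_wpDr//; last exact: (pM i).2.
by apply: sumr_ge0 => j _; exact: (posdef_psd (pM j)).2.
Qed.

(** * The lifted closed-loop matrix and the determinant of [Atilde] *)

Section LiftedSupport.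
Context {R : realType} {n m : nat} (D : lq_data R n m) (d t : nat).
Hypothesis pR : forall k, posdef (lqR D k).

Local Notation lev := (@block_level _ _).
Local Notation Rd := (\mxdiag_(i < d) (lqR D (d * t + i))).
Local Notation N := (1%:M - liftA D d t).

Lemma liftA_shift : liftA D d t = 1%:M - N.
Proof. by rewrite opprB addrC subrK. Qed.

Lemma supported_shift : supported (fun a b => a == b.+1) lev lev N.
Proof.
move=> i j; rewrite opprB addrC subrK mxE /block_level.
by case: ifP => // _; rewrite mxE eqxx.
Qed.

Lemma supported_liftA : supported (fun a b => (b <= a <= b.+1)%N) lev lev (liftA D d t).
Proof.
move=> i j; rewrite liftA_shift mxE [X in X + _]mxE [X in _ + X]mxE.
have [->|ij] := eqVneq i j; first by rewrite leqnn leqnSn.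
by rewrite add0r oppr_eq0 => /supported_shift/eqP ->; rewrite leqnSn leqnn.
Qed.

Lemma supported_liftB : supported (fun a b => a == b.+1) lev lev (liftB D d t).
Proof.
move=> i j; rewrite mxE /block_level.
by case: ifP => // _; rewrite mxE eqxx.
Qed.

Lemma supported_liftC : supported (fun a b => a == b) lev lev (liftC D d t).
Proof.
move=> i j; rewrite mxE /block_level.
by case: ifP => // _; rewrite mxE eqxx.
Qed.

(** [liftA] is unit lower block triangular, so it agrees with the identity at equal levels.
    Transposing puts the pattern in the direction [det_level] expects. *)
Lemma det_liftA : \det (liftA D d t) = 1.
Proof.
rewrite -det_tr -(det1 R (\sum_(i < d.+1) n)).
apply: (@det_level _ _ lev lev) => //.
- by move=> i j; rewrite mxE => /supported_liftA /= /andP[].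
- by move=> i j; rewrite !mxE; have [->//|ij] := eqVneq i j; rewrite eqxx.
- move=> i j ij; rewrite liftA_shift mxE [LHS]mxE [X in _ + X]mxE.
  have -> : N j i = 0.
    by apply/eqP; apply: contraT => /supported_shift; rewrite ij => /eqP/n_Sn.
  by rewrite oppr0 addr0 !mxE eq_sym.
Qed.

Lemma liftA_unit : liftA D d t \in unitmx.
Proof. by rewrite unitmxE det_liftA unitr1. Qed.

Lemma supported_invA : supported (fun a b => (b <= a)%N) lev lev (invmx (liftA D d t)).
Proof.
rewrite liftA_shift; apply: supported_inv_lower.
  by rewrite -liftA_shift liftA_unit.
by move=> i j /supported_shift/eqP ->.
Qed.

(** Strict causality: within a period, an input influences only strictly later outputs. *)
Lemma supported_Delta : supported (fun a b => (b < a)%N) lev lev (Delta D d t).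
Proof.
apply: (@supported_mul _ _ _ _ (fun a b => (b <= a)%N) (fun a b => a == b.+1) _ _ lev).
- by move=> a b c ba /eqP bc; rewrite -bc.
- apply: (@supported_mul _ _ _ _ (fun a b => a == b) (fun a b => (b <= a)%N) _ _ lev).
  + by move=> a b c /eqP ->.
  + exact: supported_liftC.
  + exact: supported_invA.
- exact: supported_liftB.
Qed.

Lemma posdef_Rd : posdef Rd.
Proof. exact: posdef_mxdiag. Qed.

Lemma posdef_Rtilde : posdef (Rtilde D d t).
Proof. by apply: posdefD; [exact: posdef_Rd|exact: psd_gram]. Qed.

(* [liftA] together with the feedback through the inputs that minimizes the
   cost of one lifted period; [Atilde] is the resulting transition matrix. *)
Definition closed_loop := liftA D d t
  + liftB D d t *m (invmx Rd *m (Delta D d t)^T *m liftC D d t).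

Local Notation La := (liftA D d t).
Local Notation Lb := (liftB D d t).
Local Notation Lc := (liftC D d t).
Local Notation De := (Delta D d t).
Local Notation Rt := (Rtilde D d t).

(** Woodbury expansion around [liftA]; it rests on 1 + Rd^-1 Delta' Delta = Rd^-1 Rtilde. Its corner
    block is the formula defining [Atilde]. *)
Lemma closed_loop_inv :
  closed_loop *m (invmx La - invmx La *m Lb *m invmx Rt *m De^T *m Lc *m invmx La)
  = 1%:M.
Proof.
have uL := liftA_unit; have uR := posdef_unit posdef_Rd.
have uRt := posdef_unit posdef_Rtilde.
rewrite mulmxBr mulmxDl mulmxV//.
set F := De^T *m Lc *m invmx La.
have -> : invmx La *m Lb *m invmx Rt *m De^T *m Lc *m invmx La
    = invmx La *m (Lb *m (invmx Rt *m F)) by rewrite /F !mulmxA.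
have -> : Lb *m (invmx Rd *m De^T *m Lc) *m invmx La = Lb *m (invmx Rd *m F).
  by rewrite /F !mulmxA.
have -> : closed_loop *m (invmx La *m (Lb *m (invmx Rt *m F)))
    = Lb *m (invmx Rt *m F + invmx Rd *m (De^T *m De) *m (invmx Rt *m F)).
  rewrite mulmxDl mulKVmx// mulmxDr; congr (_ + _).
  by rewrite /Delta !mulmxA.
rewrite -[X in Lb *m (X + _)]mul1mx -mulmxDl.
have -> : 1%:M + invmx Rd *m (De^T *m De) = invmx Rd *m Rt.
  by rewrite /Rtilde mulmxDr mulVmx.
by rewrite -(mulmxA _ Rt) mulKVmx// addrK.
Qed.

Lemma closed_loop_unit : closed_loop \in unitmx.
Proof. by case: (mulmx1_unit closed_loop_inv). Qed.

Lemma Atilde_corner :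
  Atilde D d t = last_block R n d *m invmx closed_loop *m first_block R n d.
Proof.
have -> : invmx closed_loop
    = invmx La - invmx La *m Lb *m invmx Rt *m De^T *m Lc *m invmx La.
  by rewrite -[RHS](mulKmx closed_loop_unit) closed_loop_inv mulmx1.
by rewrite mulmxBr mulmxBl /Atilde /Phi /Gamma /Xi !mulmxA.
Qed.

(** By Sylvester's identity the determinant equals det (Rd + Delta' Delta) / det Rd. *)
Lemma det_closed_loop_ge1 : 1 <= \det closed_loop.
Proof.
have [c c1 hc] := det_add_gram De posdef_Rd.
have uR := posdef_unit posdef_Rd.
suff -> : \det closed_loop = c by [].
have uL := liftA_unit.
have -> : closed_loop = La *m (1%:M + invmx La *m Lb *m (invmx Rd *m De^T *m Lc)).
  by rewrite /closed_loop mulmxDr mulmx1 !mulmxA mulmxV// mul1mx.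
rewrite det_mulmx det_liftA mul1r det_sylvester.
have -> : invmx Rd *m De^T *m Lc *m (invmx La *m Lb) = invmx Rd *m (De^T *m De).
  by rewrite /Delta !mulmxA.
have dR : \det Rd != 0 by rewrite -unitfE -unitmxE.
apply: (mulfI dR); rewrite -det_mulmx mulmxDr mulmx1 (mulmxA Rd) mulmxV// mul1mx.
by rewrite hc mulrC.
Qed.

(** The shift in [liftB] moves down by one block, but Delta' moves strictly up, so the feedback
    never reaches the subdiagonal blocks that carry the - A_k. *)
Lemma supported_feedback : supported (fun a b => (a <= b)%N) lev lev
  (Lb *m (invmx Rd *m De^T *m Lc)).
Proof.
apply: (@supported_mul _ _ _ _ (fun a b => a == b.+1) (fun a b => (a < b)%N) _ _ lev).
- by move=> a b c /eqP ->.
- exact: supported_liftB.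
apply: (@supported_mul _ _ _ _ (fun a b => (a < b)%N) (fun a b => a == b) _ _ lev).
- by move=> a b c ab /eqP <-.
- apply: (@supported_mul _ _ _ _ (fun a b => a == b) (fun a b => (a < b)%N) _ _ lev).
  + by move=> a b c /eqP ->.
  + apply: supported_inv_diag; first exact: posdef_unit posdef_Rd.
    move=> i j; rewrite mxE /block_level.
    by case: ifP => [/eqP ->//|_]; rewrite mxE eqxx.
  + exact: supported_tr supported_Delta.
- exact: supported_liftC.
Qed.

(** Raising column levels by one places the subdiagonal blocks at equal levels; the border row and
    column take the extreme levels d + 1 and 0, which balances the two level sums. *)
Let row_level (i : 'I_(\sum_(i < d.+1) n + n)) : nat :=
  if fintype.split i is inl a then lev a else d.+1.
Let col_level (i : 'I_(\sum_(i < d.+1) n + n)) : nat :=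
  if fintype.split i is inl a then (lev a).+1 else 0.

Let row_level_l a : row_level (lshift n a) = lev a.
Proof. by rewrite /row_level (unsplitK (inl a)). Qed.
Let row_level_r a : row_level (rshift _ a) = d.+1.
Proof. by rewrite /row_level (unsplitK (inr a)). Qed.
Let col_level_l a : col_level (lshift n a) = (lev a).+1.
Proof. by rewrite /col_level (unsplitK (inl a)). Qed.
Let col_level_r a : col_level (rshift _ a) = 0.
Proof. by rewrite /col_level (unsplitK (inr a)). Qed.

Let sum_levels : (\sum_i row_level i = \sum_i col_level i)%N.
Proof.
rewrite !big_split_ord /=.
under eq_bigr do rewrite row_level_l.
under [X in (_ + X)%N]eq_bigr do rewrite row_level_r.
under [X in _ = (X + _)%N]eq_bigr do rewrite col_level_l -addn1.
under [X in _ = (_ + X)%N]eq_bigr do rewrite col_level_r.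
have -> : (\sum_(i < n) d.+1 = \sum_(i < \sum_(i < d.+1) n) 1)%N.
  by rewrite sum1_card card_ord !sum_nat_const !card_ord mulnC.
by rewrite big_split /= big1_eq addn0.
Qed.

(** By [det_schur] its determinant is det M times that of minus the corner block of M^-1: [Atilde]
    for the closed loop, [Phi] for [liftA]. *)
Let bordered (M : 'M[R]_(\sum_(i < d.+1) n)) :=
  block_mx M (first_block R n d) (last_block R n d) 0.

Let supported_bordered M : supported (fun a b => (a <= b.+1)%N) lev lev M ->
  supported leq row_level col_level (bordered M).
Proof.
move=> hM i j; rewrite /bordered; case: (splitP i) => a ea; case: (splitP j) => b eb.
- have -> : i = lshift n a by apply: val_inj.
  have -> : j = lshift n b by apply: val_inj.
  by rewrite block_mxEul row_level_l col_level_l => /hM.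
- have -> : i = lshift n a by apply: val_inj.
  have -> : j = rshift _ b by apply: val_inj.
  rewrite block_mxEur row_level_l col_level_r mxE /block_level.
  by case: ifP => [/eqP ->//|_]; rewrite mxE eqxx.
- have -> : i = rshift _ a by apply: val_inj.
  have -> : j = lshift n b by apply: val_inj.
  rewrite block_mxEdl row_level_r col_level_l mxE /block_level.
  by case: ifP => [/eqP ->//|_]; rewrite mxE eqxx.
- have -> : i = rshift _ a by apply: val_inj.
  have -> : j = rshift _ b by apply: val_inj.
  by rewrite block_mxEdr mxE eqxx.
Qed.

(* Both bordered matrices are block triangular with the same diagonal blocks
   (the identity and the [- A_k]) when their columns are shifted by one block. *)
Let det_bordered : \det (bordered closed_loop) = \det (bordered La).
Proof.
have sL : supported (fun a b => (a <= b.+1)%N) lev lev La.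
  by move=> i j /supported_liftA /= /andP[].
apply: (det_level sum_levels).
- apply: supported_bordered => i j; rewrite mxE => h.
  have [/supported_feedback/leqW//|] := boolP ((Lb *m (invmx Rd *m De^T *m Lc)) i j != 0).
  by rewrite negbK => /eqP f0; apply: sL; rewrite f0 addr0 in h.
- exact: supported_bordered.
move=> i j; rewrite /bordered; case: (splitP i) => a ea; case: (splitP j) => b eb.
- have -> : i = lshift n a by apply: val_inj.
  have -> : j = lshift n b by apply: val_inj.
  rewrite !block_mxEul row_level_l col_level_l => ab.
  rewrite mxE [X in _ + X](_ : _ = 0) ?addr0//; apply/eqP.
  by apply: contraT => /supported_feedback; rewrite ab ltnn.
- have -> : i = lshift n a by apply: val_inj.
  have -> : j = rshift _ b by apply: val_inj.
  by rewrite !block_mxEur.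
- have -> : i = rshift _ a by apply: val_inj.
  have -> : j = lshift n b by apply: val_inj.
  by rewrite !block_mxEdl.
- have -> : i = rshift _ a by apply: val_inj.
  have -> : j = rshift _ b by apply: val_inj.
  by rewrite !block_mxEdr.
Qed.

(** Equal bordered determinants give |det closed_loop| |det Atilde| = |det Phi|, and the first
    factor is at least 1. *)
Lemma det_Atilde_le : `|\det (Atilde D d t)| <= `|\det (Phi D d t)|.
Proof.
have := det_bordered; rewrite /bordered !det_schur ?closed_loop_unit ?liftA_unit//.
rewrite -Atilde_corner -/(Phi D d t) det_liftA mul1r => /(congr1 Num.norm).
have dN (S : 'M[R]_n) : `|\det (- S)| = `|\det S|.
  by rewrite -scaleN1r detZ normrM normrX normrN1 expr1n mul1r.
rewrite normrM !dN => <-.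
by rewrite ler_peMl// ger0_norm ?det_closed_loop_ge1// (le_trans ler01 det_closed_loop_ge1).
Qed.

End LiftedSupport.

(** * Uniformly bounded families of matrices *)

(** Entrywise bounds, because determinants and cofactors are polynomials in the entries; for fixed
    dimensions this is equivalent to a bound on [opnorm]. *)
Definition bounded_family (R : realType) (k l : nat) (F : nat -> 'M[R]_(k, l)) :=
  exists c : R, forall t i j, `|F t i j| <= c.

Section BoundedFamily.
Context {R : realType}.

Lemma bounded_family_ge0 k l (F : nat -> 'M[R]_(k, l)) : bounded_family F ->
  exists2 c : R, 0 <= c & forall t i j, `|F t i j| <= c.
Proof.
move=> [c h]; exists `|c|; first exact: normr_ge0.
by move=> t i j; apply: le_trans (h t i j) (ler_norm _).
Qed.

Lemma bounded_familyD k l (F G : nat -> 'M[R]_(k, l)) :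
  bounded_family F -> bounded_family G -> bounded_family (fun t => F t + G t).
Proof.
move=> [a ha] [b hb]; exists (a + b) => t i j; rewrite mxE.
by apply: le_trans (ler_normD _ _) _; exact: lerD.
Qed.

Lemma bounded_familyN k l (F : nat -> 'M[R]_(k, l)) :
  bounded_family F -> bounded_family (fun t => - F t).
Proof. by move=> [a ha]; exists a => t i j; rewrite mxE normrN. Qed.

Lemma bounded_family_tr k l (F : nat -> 'M[R]_(k, l)) :
  bounded_family F -> bounded_family (fun t => (F t)^T).
Proof. by move=> [a ha]; exists a => t i j; rewrite mxE. Qed.

Lemma bounded_familyM k l q (F : nat -> 'M[R]_(k, l)) (G : nat -> 'M[R]_(l, q)) :
  bounded_family F -> bounded_family G -> bounded_family (fun t => F t *m G t).
Proof.
move=> /bounded_family_ge0[a a0 ha] /bounded_family_ge0[b b0 hb].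
exists (\sum_(i < l) a * b) => t i j; rewrite mxE.
apply: le_trans (ler_norm_sum _ _ _) _; apply: ler_sum => h _.
by rewrite normrM ler_pM.
Qed.

Lemma bounded_family_cst k l (M : 'M[R]_(k, l)) : bounded_family (fun=> M).
Proof.
exists (\sum_i \sum_j `|M i j|) => _ i j.
rewrite (bigD1 i)//= (bigD1 j)//= -addrA lerDl addr_ge0//.
  by apply: sumr_ge0.
by apply: sumr_ge0 => a _; apply: sumr_ge0.
Qed.

Lemma bounded_family_det k (F : nat -> 'M[R]_k) : bounded_family F ->
  exists c : R, forall t, `|\det (F t)| <= c.
Proof.
move=> /bounded_family_ge0[a a0 ha].
exists (\sum_(s : 'S_k) \prod_(i < k) a) => t.
apply: le_trans (ler_norm_sum _ _ _) _; apply: ler_sum => s _.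
rewrite normrM normrX normrN1 expr1n mul1r normr_prod.
by apply: ler_prod => i _; rewrite normr_ge0 ha.
Qed.

Lemma bounded_family_adj k (F : nat -> 'M[R]_k) : bounded_family F ->
  bounded_family (fun t => \adj (F t)).
Proof.
move=> [a ha].
have h i j : exists c : R, forall t, `|\adj (F t) i j| <= c.
  have [c hc] : exists c : R, forall t, `|\det (row' j (col' i (F t)))| <= c.
    by apply: bounded_family_det; exists a => t ? ?; rewrite !mxE.
  exists c => t; rewrite mxE /cofactor normrM normrX normrN1 expr1n mul1r.
  exact: hc.
have [c hc] := choice (fun ij : 'I_k * 'I_k => h ij.1 ij.2).
exists (\sum_(ij : 'I_k * 'I_k) `|c ij|) => t i j.
rewrite (bigD1 (i, j))//=; apply: (le_trans (hc (i, j) t)).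
apply: (le_trans (ler_norm _)); rewrite lerDl.
by apply: sumr_ge0.
Qed.

Lemma bounded_family_opnorm k l (F : nat -> 'M[R]_(k, l)) : bounded_family F ->
  exists2 c : R, 0 < c & forall t, opnorm (F t) <= c.
Proof.
move=> /bounded_family_ge0[a a0 ha]; exists (k%:R * (l%:R * a) + 1).
  by rewrite ltr_wpDl// !mulr_ge0.
by move=> t; apply: le_trans (opnorm_le_coord a0 (ha t)) _; rewrite lerDl.
Qed.

Lemma opnorm_bounded_family k l (F : nat -> 'M[R]_(k, l)) c :
  (forall t, opnorm (F t) <= c) -> bounded_family F.
Proof. by move=> h; exists c => t i j; apply: le_trans (coord_le_opnorm _ _ _) (h t). Qed.

Lemma bounded_family_inv_det1 k (F : nat -> 'M[R]_k) : bounded_family F ->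
  (forall t, \det (F t) = 1) -> bounded_family (fun t => invmx (F t)).
Proof.
move=> bF d1; have [a ha] := bounded_family_adj bF.
exists a => t i j; rewrite /invmx unitmxE d1 unitr1 invr1 scale1r; exact: ha.
Qed.

Lemma bounded_family_inv_ge k (F : nat -> 'M[R]_k) q : 0 < q ->
  (forall t, (F t)^T = F t) -> (forall t v, q * dot v v <= qform (F t) v) ->
  bounded_family (fun t => invmx (F t)).
Proof.
move=> q0 sF hq; apply: (@opnorm_bounded_family _ _ _ q^-1) => t.
apply: opnorm_le => [|v]; first by rewrite invr_ge0 ltW.
apply: enorm_invmx_le => //; apply: posdef_unit.
exact: posdef_ge (sF t) q0 (hq t).
Qed.

Lemma gram_ge_unit k (M : 'M[R]_k) a : 0 < a ->
  (forall v, a * dot v v <= qform (M *m M^T) v) -> M \in unitmx.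
Proof.
move=> a0 h; rewrite -unitmx_tr; apply: unitmx_ker => v Mv.
apply: dot_eq0; have := h v; rewrite qform_gramT Mv dot0r.
by rewrite pmulr_rle0// => v0; apply/eqP; rewrite eq_le v0 dot_ge0.
Qed.

(** The hypothesis says |F' v|^2 >= a |v|^2, which bounds the inverse of the transpose by
    a^(-1/2). *)
Lemma bounded_family_inv_gram k (F : nat -> 'M[R]_k) a : 0 < a ->
  (forall t v, a * dot v v <= qform (F t *m (F t)^T) v) ->
  bounded_family (fun t => invmx (F t)).
Proof.
move=> a0 h.
suff [c hc] : bounded_family (fun t => (invmx (F t))^T).
  by exists c => t i j; have := hc t j i; rewrite mxE.
apply: (@opnorm_bounded_family _ _ _ (Num.sqrt a^-1)) => t.
have uF := gram_ge_unit a0 (h t).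
apply: opnorm_le => [|v]; first exact: sqrtr_ge0.
apply: enorm_le; first by rewrite mulr_ge0 ?sqrtr_ge0 ?enorm_ge0.
rewrite exprMn sqr_sqrtr ?invr_ge0 ?(ltW a0)// enorm_sqr trmx_inv.
have := h t (invmx (F t)^T *m v); rewrite qform_gramT.
rewrite mulKVmx ?unitmx_tr// => h1.
by rewrite mulrC ler_pdivlMr// mulrC.
Qed.

End BoundedFamily.

(** * Uniform bounds on the lifted data *)

Section LiftedBounded.
Context {R : realType} {n m : nat} (D : lq_data R n m) (d : nat).
Hypothesis pR : forall k, posdef (lqR D k).
Hypothesis bA : bounded_family (lqA D).
Hypothesis bB : bounded_family (lqB D).
Hypothesis bQ : bounded_family (lqQ D).
Hypothesis bR : bounded_family (lqR D).

(** A diagonal entry of S S with S symmetric is the sum of squares of a column of S. The other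
    branch is the default value 0 of [psd_sqrt]. *)
Lemma bounded_lqC : bounded_family (lqC D).
Proof.
have [c c0 hc] := bounded_family_ge0 bQ; exists (Num.sqrt c) => t i j.
rewrite /lqC /psd_sqrt; case: xgetP => [S _ [[sS _] SQ]|_].
  rewrite -sqrtr_sqr ler_sqrt//.
  apply: le_trans (le_trans (ler_norm _) (hc t j j)).
  have -> : lqQ D t j j = \sum_k S k j ^+ 2.
    by rewrite -SQ mxE; apply: eq_bigr => k _; rewrite expr2 -[in S j k]sS mxE.
  by rewrite (bigD1 i)//= lerDl; apply: sumr_ge0 => k _; exact: sqr_ge0.
by rewrite mxE normr0 sqrtr_ge0.
Qed.

Lemma bounded_liftA : bounded_family (liftA D d).
Proof.
apply: bounded_familyD; first exact: bounded_family_cst.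
apply: bounded_familyN; have [c c0 hc] := bounded_family_ge0 bA.
by exists c => t i j; rewrite mxE; case: ifP => _; rewrite ?mxE ?normr0.
Qed.

Lemma bounded_liftB : bounded_family (liftB D d).
Proof.
have [c c0 hc] := bounded_family_ge0 bB.
by exists c => t i j; rewrite mxE; case: ifP => _; rewrite ?mxE ?normr0.
Qed.

Lemma bounded_liftC : bounded_family (liftC D d).
Proof.
have [c c0 hc] := bounded_family_ge0 bounded_lqC.
by exists c => t i j; rewrite mxE; case: ifP => _; rewrite ?mxE ?normr0.
Qed.

Lemma bounded_invA : bounded_family (fun t => invmx (liftA D d t)).
Proof.
apply: bounded_family_inv_det1; first exact: bounded_liftA.
by move=> t; exact: det_liftA.
Qed.

Lemma bounded_Phi : bounded_family (Phi D d).
Proof.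
apply: bounded_familyM; last exact: bounded_family_cst.
by apply: bounded_familyM; [exact: bounded_family_cst|exact: bounded_invA].
Qed.

Lemma bounded_Gamma : bounded_family (Gamma D d).
Proof.
apply: bounded_familyM; last exact: bounded_liftB.
by apply: bounded_familyM; [exact: bounded_family_cst|exact: bounded_invA].
Qed.

Lemma bounded_Xi : bounded_family (Xi D d).
Proof.
apply: bounded_familyM; last exact: bounded_family_cst.
by apply: bounded_familyM; [exact: bounded_liftC|exact: bounded_invA].
Qed.

Lemma bounded_Delta : bounded_family (Delta D d).
Proof.
apply: bounded_familyM; last exact: bounded_liftB.
by apply: bounded_familyM; [exact: bounded_liftC|exact: bounded_invA].
Qed.

Lemma bounded_Rtilde : bounded_family (Rtilde D d).
Proof.
apply: bounded_familyD; last first.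
  by apply: bounded_familyM; [apply: bounded_family_tr|]; exact: bounded_Delta.
have [c c0 hc] := bounded_family_ge0 bR.
exists c => t i j; rewrite mxE; case: ifP => _; last by rewrite mxE normr0.
by rewrite conform_mx_id; exact: hc.
Qed.

Lemma bounded_Atilde a : 0 < a ->
  (forall t v, a * dot v v <= qform (Atilde D d t *m (Atilde D d t)^T) v) ->
  bounded_family (Atilde D d).
Proof.
move=> a0 h; have [c hc] := bounded_family_det bounded_Phi.
have [b b0 hb] := bounded_family_ge0 (bounded_family_adj (bounded_family_inv_gram a0 h)).
exists (c * b) => t i j; set S := Atilde D d t.
have uS : S \in unitmx := gram_ge_unit a0 (h t).
have -> : S = \det S *: \adj (invmx S).
  rewrite -[LHS]invmxK {1}/invmx unitmx_inv uS.
  by rewrite det_inv invrK.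
rewrite mxE normrM ler_pM// ?hb//.
exact: le_trans (det_Atilde_le d t pR) (hc t).
Qed.

Lemma Rtilde_posdef t : posdef (Rtilde D d t).
Proof. exact: posdef_Rtilde. Qed.

Lemma Qtilde_sym t : (Qtilde D d t)^T = Qtilde D d t.
Proof.
have [sR _] := posdef_Rtilde d t pR.
rewrite /Qtilde linearB /= !trmx_mul !trmxK (trmx_invmx_sym sR).
by rewrite !mulmxA.
Qed.

Lemma Qtilde_le t v : qform (Qtilde D d t) v <= qform ((Xi D d t)^T *m Xi D d t) v.
Proof.
rewrite /Qtilde qformDl qformNl gerDl oppr_le0.
have -> : (Xi D d t)^T *m Delta D d t *m invmx (Rtilde D d t) *m (Delta D d t)^T
    *m Xi D d t = ((Delta D d t)^T *m Xi D d t)^T *m invmx (Rtilde D d t)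
    *m ((Delta D d t)^T *m Xi D d t) by rewrite (trmx_mul (Delta D d t)^T) trmxK !mulmxA.
rewrite qform_conj.
exact: (posdef_psd (posdef_inv (Rtilde_posdef t))).2.
Qed.

(** The inverse of [Rtilde] may be unbounded, so the defining formula is not estimated termwise; the
    order relation 0 <= Qtilde <= Xi' Xi gives the bound. *)
Lemma bounded_Qtilde : (forall t, psd (Qtilde D d t)) -> bounded_family (Qtilde D d).
Proof.
move=> pQ; have bX : bounded_family (fun t => (Xi D d t)^T *m Xi D d t).
  by apply: bounded_familyM; [apply: bounded_family_tr|]; exact: bounded_Xi.
have [c c0 hc] := bounded_family_opnorm bX.
apply: (@opnorm_bounded_family _ _ _ _ c) => t.
apply: psd_opnorm_le => // [|v]; first exact: ltW.
apply: le_trans (Qtilde_le t v) _; apply: le_trans (qform_le_opnorm _ _) _.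
by rewrite ler_wpM2r ?dot_ge0.
Qed.

End LiftedBounded.

(** * Finite and infinite horizon costs *)

Section Horizon.
Context {R : realType} {n p : nat} (L : lq_data R n p).
Hypothesis pQ : forall t, psd (lqQ L t).
Hypothesis pW : forall t, posdef (lqR L t).

Lemma riccati_comp_psd s j Y : psd Y -> psd (riccati_comp L s j Y).
Proof. by move=> pY; elim: j s => //= j IH s; apply: riccati_psd. Qed.

Lemma riccati_comp_mono s j Y Z : psd Y -> psd Z ->
  (forall x, qform Y x <= qform Z x) ->
  forall x, qform (riccati_comp L s j Y) x <= qform (riccati_comp L s j Z) x.
Proof.
move=> pY pZ h; elim: j s => //= j IH s.
by apply: riccati_mono => //; exact: riccati_comp_psd.
Qed.

(** Exposes the innermost operator, where the terminal penalties of two consecutive horizons can be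
    compared. *)
Lemma riccati_compSr s j Y :
  riccati_comp L s j.+1 Y = riccati_comp L s j (riccati L (s + j) Y).
Proof.
elim: j s => [|j IH] s; first by rewrite /= addn0.
by rewrite -addSnnS -[RHS]/(riccati L s (riccati_comp L s.+1 j _)) -IH.
Qed.

(** Inputs are infinite sequences here, so that dropping the first input is a plain shift and the
    recursion on the horizon goes through. *)
Definition input_cost (T t : nat) (chi : 'cV[R]_n) (u : nat -> 'cV[R]_p)
    (X : 'M[R]_n) : R :=
  \sum_(j < T) stage_cost L (t + j) (trajectory L t chi u j) (u j)
  + qform X (trajectory L t chi u T).

Lemma eq_trajectory T t chi u v j : (j <= T)%N ->
  (forall i, (i < T)%N -> u i = v i) ->
  trajectory L t chi u j = trajectory L t chi v j.
Proof.
move=> jT uv; elim: j jT => //= j IH jT.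
by rewrite IH ?uv// ltnW.
Qed.

Lemma eq_input_cost T t chi u v X : (forall i, (i < T)%N -> u i = v i) ->
  input_cost T t chi u X = input_cost T t chi v X.
Proof.
move=> uv; rewrite /input_cost (eq_trajectory _ _ (leqnn T) uv); congr (_ + _).
apply: eq_bigr => j _.
by rewrite (eq_trajectory _ _ (ltnW (ltn_ord j)) uv) uv.
Qed.

Lemma trajectoryS t chi u j :
  trajectory L t chi u j.+1
  = trajectory L t.+1 (lqA L t *m chi + lqB L t *m u 0%N) (fun k => u k.+1) j.
Proof.
elim: j => [|j IH]; first by rewrite /= addn0.
by rewrite [LHS]/= -[X in _ *m X + _]/(trajectory L t chi u j.+1) IH /= addnS.
Qed.

Lemma input_costS T t chi u X :
  input_cost T.+1 t chi u X = stage_cost L t chi (u 0%N)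
  + input_cost T t.+1 (lqA L t *m chi + lqB L t *m u 0%N) (fun k => u k.+1) X.
Proof.
rewrite /input_cost big_ord_recl addn0 -addrA; congr (_ + (_ + _)).
  by apply: eq_bigr => j _; rewrite lift0 trajectoryS addnS.
by rewrite trajectoryS.
Qed.

Lemma riccati_comp_le_cost T t chi u X : psd X ->
  qform (riccati_comp L t T X) chi <= input_cost T t chi u X.
Proof.
move=> pX; elim: T t chi u => [|T IH] t chi u.
  by rewrite /input_cost big_ord0 add0r.
rewrite input_costS /=; apply: le_trans (lerD (lexx _) (IH _ _ _)).
by apply: riccati_le_cost => //; exact: riccati_comp_psd.
Qed.

Lemma riccati_comp_attained T t chi X : psd X ->
  exists u, input_cost T t chi u X = qform (riccati_comp L t T X) chi.
Proof.
move=> pX; elim: T t chi => [|T IH] t chi.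
  by exists (fun=> 0); rewrite /input_cost big_ord0 add0r.
have pY := riccati_comp_psd t.+1 T pX.
set u0 := - (gain L t (riccati_comp L t.+1 T X) *m chi).
have [v hv] := IH t.+1 (lqA L t *m chi + lqB L t *m u0).
exists (fun k => if k is k'.+1 then v k' else u0).
rewrite input_costS /= (eq_input_cost _ _ _ (v := v))// hv.
by rewrite riccati_gain_cost// mulmxBl -(mulmxA (lqB L t)) /u0 mulmxN.
Qed.

Lemma horizon_costE T t chi (w : {ffun 'I_T -> 'cV[R]_p}) X :
  horizon_cost L t chi w X = input_cost T t chi (extend0 w) X.
Proof.
rewrite /horizon_cost /input_cost; congr (_ + _); apply: eq_bigr => j _.
by rewrite /extend0 valK.
Qed.

(** Dynamic programming attains the lower bound, so the set given to [xget] is inhabited and the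
    choice is a true minimizer rather than the default. *)
Lemma horizon_argmin_cost T t chi X : psd X ->
  horizon_cost L t chi (horizon_argmin L T t chi X) X
  = qform (riccati_comp L t T X) chi.
Proof.
move=> pX; have [u hu] := riccati_comp_attained T t chi pX.
pose w : {ffun 'I_T -> 'cV[R]_p} := [ffun j : 'I_T => u j].
have hw : horizon_cost L t chi w X = qform (riccati_comp L t T X) chi.
  rewrite horizon_costE -hu; apply: eq_input_cost => i iT.
  by rewrite /extend0 (insubT (fun k => (k < T)%N) iT) ffunE.
have hmin : [set w | forall w' : {ffun 'I_T -> 'cV[R]_p},
    horizon_cost L t chi w X <= horizon_cost L t chi w' X]
    (horizon_argmin L T t chi X).
  apply: xgetPex; exists w => w'.
  by rewrite hw horizon_costE riccati_comp_le_cost.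
apply/eqP; rewrite eq_le; apply/andP; split; first by rewrite -hw; exact: hmin.
by rewrite horizon_costE riccati_comp_le_cost.
Qed.

(** Only the optimal value of the minimizer enters: once the first stage is split off, any tail of
    inputs costs at least the form of [Xhat_next]. *)
Lemma mu_RH_optimal T X t x : (0 < T)%N -> (forall t, psd (X t)) ->
  stage_cost L t x (mu_RH L T X t x)
  + qform (Xhat_next L T X t) (lqA L t *m x + lqB L t *m mu_RH L T X t x)
  <= qform (riccati L t (Xhat_next L T X t)) x.
Proof.
case: T => // T _ pX; have := horizon_argmin_cost T.+1 t x (pX (t + T.+1)%N).
rewrite horizon_costE input_costS => h.
rewrite /Xhat_next [T.+1.-1]/= -[leRHS]/(qform (riccati_comp L t T.+1 _) x) -h.
by rewrite lerD2l riccati_comp_le_cost.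
Qed.

Section Policy.
Variable mu : nat -> 'cV[R]_n -> 'cV[R]_p.

Fixpoint policy_state (xi : 'cV[R]_n) (t : nat) : 'cV[R]_n :=
  if t is t'.+1 then
    let x := policy_state xi t' in lqA L t' *m x + lqB L t' *m mu t' x
  else xi.

Definition policy_input xi t := mu t (policy_state xi t).

Lemma policy_trajectory xi t :
  trajectory L 0 xi (policy_input xi) t = policy_state xi t.
Proof. by elim: t => //= t ->; rewrite add0n. Qed.

End Policy.

Definition partial_cost xi u N : R :=
  \sum_(0 <= t < N) stage_cost L t (trajectory L 0 xi u t) (u t).

Lemma partial_cost_nd xi u : nondecreasing_seq (fun N => (partial_cost xi u N)%:E).
Proof.
apply/nondecreasing_seqP => N; rewrite lee_fin /partial_cost big_nat_recr//= lerDl.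
exact: stage_cost_ge0.
Qed.

Lemma partial_cost_le_total xi u N : ((partial_cost xi u N)%:E <= total_cost L xi u)%E.
Proof.
have h := ereal_nondecreasing_cvgn (@partial_cost_nd xi u).
rewrite /total_cost (cvg_lim _ h)//.
by apply: ereal_sup_ubound; exists N.
Qed.

Lemma total_cost_le xi u (c : R) : (forall N, partial_cost xi u N <= c) ->
  (total_cost L xi u <= c%:E)%E.
Proof.
move=> hc; have h := ereal_nondecreasing_cvgn (@partial_cost_nd xi u).
rewrite /total_cost (cvg_lim _ h)//.
by apply: ge_ereal_sup => _ [N _ <-]; rewrite lee_fin.
Qed.

(** [V] acts as a Lyapunov function: the accumulated cost plus the current value of [V] never
    increases. *)
Lemma policy_total_cost_le mu (V : nat -> 'M[R]_n) xi : (forall t, psd (V t)) ->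
  (forall t x, stage_cost L t x (mu t x)
    + qform (V t.+1) (lqA L t *m x + lqB L t *m mu t x) <= qform (V t) x) ->
  (total_cost L xi (policy_input mu xi) <= (qform (V 0%N) xi)%:E)%E.
Proof.
move=> pV h; apply: total_cost_le => N.
apply: (@le_trans _ _ (partial_cost xi (policy_input mu xi) N
    + qform (V N) (policy_state mu xi N))); first by rewrite lerDl; exact: (pV N).2.
elim: N => [|N IH]; first by rewrite /partial_cost big_nil add0r.
apply: le_trans IH; rewrite /partial_cost big_nat_recr//= -addrA lerD2l.
by rewrite policy_trajectory; exact: h.
Qed.

Section Optimal.
Variable P : nat -> 'M[R]_n.
Hypothesis pP : forall t, psd (P t).
Hypothesis PE : forall t, P t = riccati L t (P t.+1).

Lemma optimal_le_partial xi u N :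
  qform (P 0%N) xi <= partial_cost xi u N + qform (P N) (trajectory L 0 xi u N).
Proof.
elim: N => [|N IH]; first by rewrite /partial_cost big_nil add0r.
apply: le_trans IH _; rewrite /partial_cost big_nat_recr//= -addrA lerD2l PE.
by rewrite add0n; exact: riccati_le_cost.
Qed.

Variables (q c : R).
Hypothesis q0 : 0 < q.
Hypothesis Qq : forall t v, q * dot v v <= qform (lqQ L t) v.
Hypothesis Pc : forall t v, qform (P t) v <= c * dot v v.

(* If the total cost were smaller, every stage would cost at least a fixed
   positive amount: the terminal weight [P N] is bounded by a multiple of [Q N]. *)
Lemma optimal_le_total xi u : ((qform (P 0%N) xi)%:E <= total_cost L xi u)%E.
Proof.
rewrite leNgt; apply/negP => lt.
have := partial_cost_le_total xi u 0; rewrite {1}/partial_cost big_nil => ge0.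
have [r er] : exists r, total_cost L xi u = r%:E.
  by case: (total_cost L xi u) lt ge0 => [r| |]//; exists r.
have le_r N : partial_cost xi u N <= r.
  by rewrite -lee_fin -er partial_cost_le_total.
rewrite er lte_fin in lt.
pose c1 := `|c| + 1; have c10 : 0 < c1 by rewrite ltr_wpDl.
(* As partial costs are at most [r], [P N] at the current state is at least [qform (P 0) xi - r];
   the factor [q / c1] turns this into a lower bound on the stage cost. *)
pose del := (qform (P 0%N) xi - r) * q / c1.
have del0 : 0 < del by rewrite divr_gt0// mulr_gt0// subr_gt0.
have step N : del <= stage_cost L N (trajectory L 0 xi u N) (u N).
  have h1 := optimal_le_partial xi u N; have h2 := le_r N.
  set x := trajectory L 0 xi u N in h1 *.
  have h3 : qform (P N) x <= c1 * dot x x.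
    apply: le_trans (Pc N x) _; rewrite ler_wpM2r ?dot_ge0// /c1.
    by have := ler_norm c; lra.
  have h4 : q * dot x x <= stage_cost L N x (u N).
    apply: le_trans (Qq N x) _; rewrite /stage_cost lerDl.
    exact: (posdef_psd (pW N)).2.
  apply: le_trans h4; rewrite /del ler_pdivrMr// mulrC -mulrA ler_pM2l//.
  by rewrite mulrC; lra.
have grow N : N%:R * del <= partial_cost xi u N.
  elim: N => [|N IH]; first by rewrite /partial_cost big_nil mul0r.
  rewrite /partial_cost big_nat_recr//= -/(partial_cost xi u N).
  by rewrite -natr1 mulrDl mul1r lerD.
have := archi_boundP (normr_ge0 (r / del)).
set N := Num.bound _ => hN; have := le_trans (grow N) (le_r N).
rewrite -ler_pdivlMr// => h; have := lt_le_trans hN h.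
by rewrite ltNge ler_norm.
Qed.

Definition optimal_policy t x : 'cV[R]_p := - (gain L t (P t.+1) *m x).

Lemma optimal_policy_le xi :
  (total_cost L xi (policy_input optimal_policy xi) <= (qform (P 0%N) xi)%:E)%E.
Proof.
apply: policy_total_cost_le => // t x.
rewrite [in leRHS]PE riccati_gain_cost// mulmxBl -(mulmxA (lqB L t)).
by rewrite /optimal_policy mulmxN.
Qed.

Lemma optimal_policy_cost xi :
  total_cost L xi (policy_input optimal_policy xi) = (qform (P 0%N) xi)%:E.
Proof.
by apply/eqP; rewrite eq_le optimal_policy_le optimal_le_total.
Qed.

Lemma optimal_costE xi : optimal_cost L xi = (qform (P 0%N) xi)%:E.
Proof.
apply/eqP; rewrite eq_le; apply/andP; split.
  apply: ereal_inf_lbound; exists (policy_input optimal_policy xi) => //.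
  exact: optimal_policy_cost.
by apply: le_ereal_inf_tmp => _ [u _ <-]; exact: optimal_le_total.
Qed.

End Optimal.

(** The Lyapunov function is W_t = R_t(Xhat_(t+1)). Its decrease needs W_(t+1) <= Xhat_(t+1): both
    apply the same T - 1 operators, to R_(t+T)(X_(t+T+1)) and to X_(t+T) respectively. *)
Lemma RH_total_cost_le T X xi : (0 < T)%N -> (forall t, psd (X t)) ->
  (forall t x, qform (riccati L t (X t.+1)) x <= qform (X t) x) ->
  (total_cost L xi (RH_input L T X xi)
    <= (qform (riccati L 0 (Xhat_next L T X 0)) xi)%:E)%E.
Proof.
move=> T0 pX hX.
have -> : RH_input L T X xi = policy_input (mu_RH L T X) xi.
  apply/funext => t; rewrite /RH_input /policy_input; congr (mu_RH _ _ _ _ _).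
  by elim: t => //= t ->.
have pXh t : psd (Xhat_next L T X t) by exact: riccati_comp_psd.
apply: (policy_total_cost_le (V := fun t => riccati L t (Xhat_next L T X t))).
  by move=> t; exact: riccati_psd.
move=> t x; apply: le_trans (mu_RH_optimal t x T0 pX); rewrite lerD2l.
case: T T0 {pXh} => // T _; rewrite /Xhat_next /=.
rewrite -[X in qform X _ <= _]/(riccati_comp L t.+1 T.+1 _) riccati_compSr.
apply: riccati_comp_mono => //; first exact: riccati_psd.
move=> y; have -> : (t.+1 + T.+1 = (t.+1 + T).+1)%N by rewrite addnS.
by have -> : (t + T.+1 = t.+1 + T)%N by rewrite addnS.
Qed.

End Horizon.

(** * The constants of the performance bound *)

Section Extrema.
Context {R : realType}.
Implicit Types f : nat -> R.

Lemma esup_seq_fin f c : (forall t, f t <= c) ->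
  exists r : R, [/\ esup_seq f = r%:E, r <= c & forall t, f t <= r].
Proof.
move=> h.
have le_c : (esup_seq f <= c%:E)%E.
  by apply: ge_ereal_sup => _ [t _ <-]; rewrite lee_fin.
have ge_f t : ((f t)%:E <= esup_seq f)%E by apply: ereal_sup_ubound; exists t.
case: (esup_seq f) le_c ge_f => [r| |]//.
- by rewrite lee_fin => rc hr; exists r; split=> // t; rewrite -lee_fin.
- by move=> _ /(_ 0%N).
Qed.

Lemma einf_seq_fin f c : (forall t, c <= f t) ->
  exists r : R, [/\ einf_seq f = r%:E, c <= r & forall t, r <= f t].
Proof.
move=> h.
have le_c : (c%:E <= einf_seq f)%E.
  by apply: le_ereal_inf_tmp => _ [t _ <-]; rewrite lee_fin.
have ge_f t : (einf_seq f <= (f t)%:E)%E by apply: ereal_inf_lbound; exists t.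
case: (einf_seq f) le_c ge_f => [r| |]//.
- by rewrite lee_fin => rc hr; exists r; split=> // t; rewrite -lee_fin.
- by move=> _ /(_ 0%N).
Qed.

Lemma einf_seq_gt0 f : (0 < einf_seq f)%E ->
  exists2 c : R, 0 < c & forall t, c <= f t.
Proof.
have ge_f t : (einf_seq f <= (f t)%:E)%E by apply: ereal_inf_lbound; exists t.
case: (einf_seq f) ge_f => [r| |]//.
- by move=> hr; rewrite lte_fin => r0; exists r => // t; rewrite -lee_fin.
- by move=> /(_ 0%N).
Qed.

End Extrema.

(** * The performance bound under uniform quadratic form estimates *)

Section PerformanceLoss.
Context {R : realType} {n p : nat} (L : lq_data R n p).
Hypothesis n0 : (0 < n)%N.
Hypothesis pW : forall t, posdef (lqR L t).
Hypothesis sQ : forall t, (lqQ L t)^T = lqQ L t.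
Variables (q b a : R).
Hypothesis q0 : 0 < q.
Hypothesis Qq : forall t v, q * dot v v <= qform (lqQ L t) v.
Hypothesis b0 : 0 < b.
Hypothesis Bb : forall t v, b * dot v v <= qform (lqB L t *m (lqB L t)^T) v.
Hypothesis a0 : 0 < a.
Hypothesis Aa : forall t v, a * dot v v <= qform (lqA L t *m (lqA L t)^T) v.
Hypothesis bA : bounded_family (lqA L).
Hypothesis bB : bounded_family (lqB L).
Hypothesis bQ : bounded_family (lqQ L).
Hypothesis bW : bounded_family (lqR L).

Let pdQ t : posdef (lqQ L t) := posdef_ge (sQ t) q0 (Qq t).
Let pQ t : psd (lqQ L t) := posdef_psd (pdQ t).
Let uA t : lqA L t \in unitmx := gram_ge_unit a0 (Aa t).
Let sBB t : (lqB L t *m (lqB L t)^T)^T = lqB L t *m (lqB L t)^T.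
Proof. by rewrite trmx_mul trmxK. Qed.
Let uBB t : lqB L t *m (lqB L t)^T \in unitmx :=
  posdef_unit (posdef_ge (sBB t) b0 (Bb t)).

Let T t := invmx (lqA L t) *m lqB L t.
Let E t := T t *m invmx (lqR L t + (T t)^T *m lqQ L t *m T t) *m (T t)^T.
Let V t := lqQ L t + lqQ L t *m T t *m invmx (lqR L t) *m (T t)^T *m lqQ L t.

Let zetaE t : zeta L t = opnorm (invmx (V t)).
Proof. by rewrite /zeta /V /T trmx_mul trmx_inv !mulmxA. Qed.

Let epsilonE t : epsilon L t = lambda_min (E t).
Proof. by rewrite /epsilon /E /T trmx_mul trmx_inv !mulmxA. Qed.

Let pdV t : posdef (V t).
Proof.
apply: posdefD => //.
have -> : lqQ L t *m T t *m invmx (lqR L t) *m (T t)^T *m lqQ L t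
    = ((T t)^T *m lqQ L t)^T *m invmx (lqR L t) *m ((T t)^T *m lqQ L t).
  by rewrite (trmx_mul (T t)^T) trmxK sQ !mulmxA.
by apply: psd_conj; apply: posdef_psd; exact: posdef_inv.
Qed.

Let V_ge t v : q * dot v v <= qform (V t) v.
Proof.
apply: le_trans (Qq t v) _; rewrite qformDl lerDl.
have -> : lqQ L t *m T t *m invmx (lqR L t) *m (T t)^T *m lqQ L t
    = ((T t)^T *m lqQ L t)^T *m invmx (lqR L t) *m ((T t)^T *m lqQ L t).
  by rewrite (trmx_mul (T t)^T) trmxK sQ !mulmxA.
by rewrite qform_conj; exact: (posdef_psd (posdef_inv (pW t))).2.
Qed.

Let zeta_le t : zeta L t <= q^-1.
Proof.
rewrite zetaE; apply: psd_opnorm_le; first exact: posdef_psd (posdef_inv (pdV t)).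
  by rewrite invr_ge0 ltW.
exact: invmx_le (pdV t) q0 (V_ge t).
Qed.

Let pdH t : posdef (lqR L t + (T t)^T *m lqQ L t *m T t).
Proof. by apply: posdefD => //; apply: psd_conj. Qed.

Let sE t : (E t)^T = E t.
Proof.
by rewrite /E !(trmx_mul (T t *m _)) (trmx_mul (T t)) trmxK (posdef_inv (pdH t)).1 mulmxA.
Qed.

(** E = T H^-1 T' with H bounded by [h]; the bound on B B' contributes [b], and |(A')^-1 v| >= |v| /
    c contributes c^-2, where [c] bounds the norm of A'. *)
Let epsilon_ge : exists2 e, 0 < e & forall t, e <= epsilon L t.
Proof.
have bT : bounded_family T.
  by apply: bounded_familyM => //; exact: bounded_family_inv_gram a0 Aa.
have bH : bounded_family (fun t => lqR L t + (T t)^T *m lqQ L t *m T t).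
  apply: bounded_familyD => //; apply: bounded_familyM => //.
  by apply: bounded_familyM => //; exact: bounded_family_tr.
have [h h0 hh] := bounded_family_opnorm bH.
have [c c0 hc] := bounded_family_opnorm (bounded_family_tr bA).
exists (h^-1 * (b / c ^+ 2)).
  by rewrite mulr_gt0 ?invr_gt0// divr_gt0 ?exprn_gt0.
move=> t; rewrite epsilonE; apply: le_lambda_min => // v.
have -> : qform (E t) v
    = qform (invmx (lqR L t + (T t)^T *m lqQ L t *m T t)) ((T t)^T *m v).
  by rewrite -qform_conj trmxK.
have Hh w : qform (lqR L t + (T t)^T *m lqQ L t *m T t) w <= h * dot w w.
  by apply: le_trans (qform_le_opnorm _ _) _; rewrite ler_wpM2r ?dot_ge0.
apply: le_trans (invmx_ge (pdH t) h0 Hh _); rewrite -mulrA ler_pM2l ?invr_gt0//.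
rewrite /T trmx_mul -mulmxA -qform_gramT; apply: le_trans (Bb t _).
rewrite trmx_inv -mulrA ler_pM2l// mulrC ler_pdivrMr ?exprn_gt0//.
set w := invmx _ *m v; have -> : v = (lqA L t)^T *m w by rewrite mulKVmx ?unitmx_tr.
rewrite -!enorm_sqr -exprMn ler_sqr ?nnegrE ?mulr_ge0 ?enorm_ge0// ?(ltW c0)//.
rewrite mulrC; apply: le_trans (enorm_le_opnorm _ _) _.
by rewrite ler_wpM2r ?enorm_ge0.
Qed.

Local Notation X := (terminal_penalty L).

Let pX t : psd (X t).
Proof. exact: terminal_penalty_psd. Qed.

Let bX : exists2 c : R, 0 < c & forall t, opnorm (X t) <= c.
Proof.
apply: bounded_family_opnorm.
have bG := bounded_family_inv_ge b0 sBB Bb.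
apply: bounded_familyD => //.
repeat (apply: bounded_familyM => //); exact: bounded_family_tr.
Qed.

Let pXh N t : psd (Xhat_next L N X t).
Proof. exact: riccati_comp_psd. Qed.

Variable P : nat -> 'M[R]_n.
Hypothesis pdP : forall t, posdef (P t).
Hypothesis bP : exists M : R, forall t, opnorm (P t) <= M.
Hypothesis PE : forall t, P t = riccati L t (P t.+1).

Let pP t : psd (P t) := posdef_psd (pdP t).

Let P_ge t v : q * dot v v <= qform (P t) v.
Proof. by apply: le_trans (Qq t v) _; rewrite PE; exact: riccati_ge_Q. Qed.

Let lambda_min_P_ge t : q <= lambda_min (P t).
Proof. by apply: le_lambda_min; [exact: n0|exact: (pP t).1|exact: P_ge]. Qed.

(** Evaluate the strict suboptimality of the deadbeat input at an eigenvector of P_t for its least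
    eigenvalue; this makes [delta_up] positive. *)
Let lambda_min_P_lt t : lambda_min (P t) < opnorm (X t).
Proof.
have [v v0 Pv] := lambda_minP n0 (pP t).1.
have : qform (P t) v < opnorm (X t) * dot v v.
  apply: lt_le_trans (qform_le_opnorm _ _).
  by rewrite PE; exact: riccati_lt_terminal_penalty.
by rewrite qformE Pv dotZr ltr_pM2r// dot_gt0.
Qed.

Lemma riccati_comp_contraction z e s : 0 <= z -> 0 < e -> 0 <= s ->
  (forall t, zeta L t <= z) -> (forall t, e <= epsilon L t) ->
  forall j t Y, psd Y -> (forall x, qform Y x <= expR s * qform (P (t + j)) x) ->
  forall x, qform (riccati_comp L t j Y) x
    <= expR ((z / (z + e)) ^+ j * s) * qform (P t) x.
Proof.
move=> z0 e0 s0 hz he; elim=> [|j IH] t Y pY hY x /=.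
  by rewrite expr0 mul1r; have := hY x; rewrite addn0.
rewrite exprS -mulrA PE; apply: riccati_contraction => //.
- exact: riccati_comp_psd.
- by rewrite mulr_ge0// exprn_ge0// divr_ge0//; lra.
- move=> v; apply: le_trans (qform_le_opnorm _ _) _; rewrite ler_wpM2r ?dot_ge0//.
  by have := hz t; rewrite zetaE.
- move=> v; apply: le_trans (lambda_min_le v n0 (sE t)); rewrite ler_wpM2r ?dot_ge0//.
  by have := he t; rewrite epsilonE.
- by apply: IH => // v; rewrite addSnnS.
Qed.

Lemma receding_horizon_loss (N : nat) : (0 < N)%N ->
  [/\ (zeta_up L < +oo)%E,
      (0 < epsilon_low L)%E,
      [/\ (0 < omega_up L N X < +oo)%E,
          (0 < omega_low L N X < +oo)%E,
          (0 < lambda_low L N X < +oo)%E,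
          (0 < lambda_up P < +oo)%E &
          (0 < delta_up N X P < +oo)%E] &
      forall xi : 'cV[R]_n,
        [/\ optimal_cost L xi \is a fin_num,
            exists v, total_cost L xi v = optimal_cost L xi &
            (performance_loss L xi (RH_input L N X xi)
             <= (loss_bound L N X P xi)%:E)%E]].
Proof.
move=> N0.
pose W t := riccati L t (Xhat_next L N X t).
have pWt t : psd (W t) by apply: riccati_psd.
have W_ge t v : q * dot v v <= qform (W t) v.
  by apply: le_trans (Qq t v) _; exact: riccati_ge_Q.
have [cX cX0 hcX] := bX.
have W_le t : opnorm (W t) <= cX.
  apply: psd_opnorm_le => // [|v]; first exact: ltW.
  apply: (@le_trans _ _ (qform (X t) v)); first exact: riccati_le_terminal_penalty.
  by apply: le_trans (qform_le_opnorm _ _) _; rewrite ler_wpM2r ?dot_ge0.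
have [z [zE z_le hz]] := esup_seq_fin zeta_le.
have [e1 e10 he1] := epsilon_ge.
have [e [eE e_ge he]] := einf_seq_fin he1.
have [wu [wuE _ hwu]] := esup_seq_fin W_le.
have lW t : q <= lambda_min (W t).
  by apply: le_lambda_min; [exact: n0|exact: (pWt t).1|exact: W_ge].
have [wl [wlE wl_ge hwl]] := einf_seq_fin lW.
have sKW t : (lqQ L t + (RH_gain L N X t)^T *m lqR L t *m RH_gain L N X t)^T
    = lqQ L t + (RH_gain L N X t)^T *m lqR L t *m RH_gain L N X t.
  by case: (psdD (pQ t) (psd_conj (RH_gain L N X t) (posdef_psd (pW t)))).
have lK t : q <= lambda_min (lqQ L t + (RH_gain L N X t)^T *m lqR L t *m RH_gain L N X t).
  apply: le_lambda_min => // v; apply: le_trans (Qq t v) _.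
  by rewrite qformDl lerDl qform_conj; exact: (posdef_psd (pW t)).2.
have [ll [llE ll_ge hll]] := einf_seq_fin lK.
have [cP hcP] := bP.
have [lu [luE lu_le hlu]] := esup_seq_fin hcP.
have ratio_le t : opnorm (X (t + N)%N) / lambda_min (P (t + N)%N) <= cX / q.
  apply: ler_pM; rewrite ?opnorm_ge0 ?invr_ge0 ?lef_pV2 ?posrE//.
    exact: le_trans (ltW q0) (lambda_min_P_ge _).
  exact: lt_le_trans q0 (lambda_min_P_ge _).
have [r [rE _ hr]] := esup_seq_fin ratio_le.
have r1 : 1 < r.
  apply: lt_le_trans (hr 0%N); rewrite ltr_pdivlMr ?mul1r ?lambda_min_P_lt//.
  exact: lt_le_trans q0 (lambda_min_P_ge _).
have z0 : 0 <= z by apply: le_trans (hz 0%N); rewrite zetaE opnorm_ge0.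
have e0 : 0 < e := lt_le_trans e10 e_ge.
have wl0 : 0 < wl := lt_le_trans q0 wl_ge.
have ll0 : 0 < ll := lt_le_trans q0 ll_ge.
have wl_wu : wl <= wu.
  apply: le_trans (hwl 0%N) _; apply: le_trans (hwu 0%N).
  exact: lambda_min_le_opnorm n0 (pWt 0%N).1 (fun w => lexx _).
(* The stage cost under the gain is one part of the form of W_0. *)
have ll_wu : ll <= wu.
  apply: le_trans (hll 0%N) _; apply: le_trans (hwu 0%N).
  apply: lambda_min_le_opnorm => // v; exact: gain_weight_le.
have wu0 : 0 < wu := lt_le_trans wl0 wl_wu.
have lu0 : 0 < lu.
  apply: lt_le_trans (hlu 0%N); apply: lt_le_trans q0 _.
  apply: le_trans (lambda_min_P_ge 0%N) _.
  exact: lambda_min_le_opnorm n0 (pP 0%N).1 (fun w => lexx _).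
have lnr0 : 0 < ln r by rewrite ln_gt0.
have dE : delta_up N X P = (Num.sqrt n%:R * ln r)%:E.
  by rewrite /delta_up rE lne_EFin ?EFinM// (lt_trans ltr01).
have sn1 : 1 <= Num.sqrt n%:R :> R by rewrite -[leLHS]sqrtr1 ler_sqrt ?ler1n.
have wuE' : omega_up L N X = wu%:E by [].
have wlE' : omega_low L N X = wl%:E by [].
have llE' : lambda_low L N X = ll%:E by [].
have luE' : lambda_up P = lu%:E by [].
have zE' : zeta_up L = z%:E by [].
have eE' : epsilon_low L = e%:E by [].
split.
- by rewrite zE' ltry.
- by rewrite eE' lte_fin.
- split; rewrite ?wuE' ?wlE' ?llE' ?luE' ?dE lte_fin ltry ?andbT//.
  by rewrite mulr_gt0// (lt_le_trans ltr01 sn1).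
move=> xi.
have Pc t v : qform (P t) v <= lu * dot v v.
  by apply: le_trans (qform_le_opnorm _ _) _; rewrite ler_wpM2r ?dot_ge0.
have oE := optimal_costE pQ pW pP PE q0 Qq Pc xi.
rewrite oE; split=> //.
  by eexists; exact: (optimal_policy_cost pQ pW pP PE q0 Qq Pc xi).
rewrite /performance_loss oE.
have hRH : (total_cost L xi (RH_input L N X xi) <= (qform (W 0%N) xi)%:E)%E.
  apply: RH_total_cost_le => // t x; exact: riccati_le_terminal_penalty.
apply: (le_trans (leeB hRH (lexx _))).
rewrite -EFinB lee_fin /loss_bound wuE' wlE' llE' luE' zE' eE' dE /=.
set rho := z / (z + e).
have rho01 : 0 <= rho <= 1.
  by rewrite divr_ge0 ?ler_pdivrMr ?mul1r ?lerDl//=; lra.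
(* The starting distance is s = ln r: |X_N| <= r lambda_min(P_N) yields X_N <= r P_N. *)
have hX x : qform (X N) x <= expR (ln r) * qform (P (0 + N)) x.
  rewrite lnK ?posrE ?(lt_trans ltr01)// add0n.
  apply: le_trans (qform_le_opnorm _ _) _.
  apply: (@le_trans _ _ (r * (lambda_min (P N) * dot x x))); last first.
    by rewrite ler_pM2l ?(lt_trans ltr01)// lambda_min_le// (pP N).1.
  rewrite mulrA ler_wpM2r ?dot_ge0// -ler_pdivrMr; first exact: (hr 0%N).
  exact: lt_le_trans q0 (lambda_min_P_ge _).
have hW : qform (W 0%N) xi
    <= expR (rho ^+ N.-1 * (Num.sqrt n%:R * ln r)) * qform (P 0%N) xi.
  have := riccati_comp_contraction z0 e0 (ltW lnr0) hz he (pX N) hX xi.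
  have -> : riccati_comp L 0 N (X N) = W 0%N.
    by rewrite /W /Xhat_next add0n; case: (N) N0.
  (* All N operators contract, giving rho^N ln r; rho <= 1 and sqrt n >= 1 weaken it to the stated
     exponent. *)
  move=> h; apply: le_trans h _; rewrite -/rho ler_wpM2r ?(pP 0%N).2// ler_expR.
  have [rho0 rho1] := andP rho01.
  apply: (@le_trans _ _ (rho ^+ N.-1 * ln r)).
    rewrite ler_wpM2r ?(ltW lnr0)//.
    by case: (N) N0 => // k _; rewrite exprS /= ler_piMl// exprn_ge0.
  by rewrite ler_wpM2l ?exprn_ge0// ler_peMl// ltW.
set eta := expR _ in hW *.
have eta1 : 0 <= eta - 1.
  rewrite subr_ge0 -[leLHS]expR0 ler_expR mulr_ge0 ?exprn_ge0//.
    by case/andP: rho01.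
  by rewrite mulr_ge0 ?sqrtr_ge0// ltW.
apply: (@le_trans _ _ ((eta - 1) * (lu * dot xi xi))).
  apply: (@le_trans _ _ ((eta - 1) * qform (P 0%N) xi)).
    by rewrite mulrBl mul1r lerD2r.
  by rewrite ler_wpM2l.
rewrite enorm_sqr; set c := (eta - 1) * _.
have -> : lu / ll * (wu / wl) * wu * (eta - 1) * dot xi xi
    = c * (wu / ll * (wu / wl)) by rewrite /c; ring.
apply: ler_peMr; first by rewrite mulr_ge0// mulr_ge0 ?dot_ge0// ltW.
(* The factors left over, wu / ll and wu / wl, are each at least 1. *)
rewrite -[leLHS]mulr1; apply: ler_pM => //; by rewrite ler_pdivlMr// mul1r.
Qed.

End PerformanceLoss.

Theorem theorem4 (R : realType) (n m d T : nat) (D : lq_data R n m)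
    (P : nat -> 'M[R]_n) :
  (0 < n)%N -> (0 < m)%N -> (0 < d)%N -> (0 < T)%N ->
  (forall k, psd (lqQ D k)) ->
  (forall k, posdef (lqR D k)) ->
  (exists M : R, forall k, [/\ opnorm (lqA D k) <= M, opnorm (lqB D k) <= M,
                               opnorm (lqQ D k) <= M & opnorm (lqR D k) <= M]) ->
  (forall k, lqA D k \in unitmx) ->
  (forall k, row_free (controllability_mx D k d)) ->
  (forall k, row_full (observability_mx D k d)) ->
  let L := lifted D d in
  (0 < einf_seq (fun t => lambda_min (lqQ L t)))%E ->
  (0 < einf_seq (fun t => lambda_min (lqB L t *m (lqB L t)^T)))%E ->
  (0 < einf_seq (fun t => lambda_min (lqA L t *m (lqA L t)^T)))%E ->
  (forall t, posdef (P t)) ->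
  (exists M : R, forall t, opnorm (P t) <= M) ->
  (forall t, P t = riccati L t (P t.+1)) ->
  let X := terminal_penalty L in
  [/\ (zeta_up L < +oo)%E,
      (0 < epsilon_low L)%E,
      [/\ (0 < omega_up L T X < +oo)%E,
          (0 < omega_low L T X < +oo)%E,
          (0 < lambda_low L T X < +oo)%E,
          (0 < lambda_up P < +oo)%E &
          (0 < delta_up T X P < +oo)%E] &
      forall xi : 'cV[R]_n,
        [/\ optimal_cost L xi \is a fin_num,
            exists v, total_cost L xi v = optimal_cost L xi &
            (performance_loss L xi (RH_input L T X xi)
             <= (loss_bound L T X P xi)%:E)%E]].
Proof.
move=> n0 _ _ T0 _ pR [M hM] _ _ _ L /einf_seq_gt0[q q0 hq] /einf_seq_gt0[b b0 hb].
move=> /einf_seq_gt0[a a0 ha] pP bP PE X.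
have bA : bounded_family (lqA D).
  by apply: (@opnorm_bounded_family _ _ _ _ M) => k; case: (hM k).
have bB : bounded_family (lqB D).
  by apply: (@opnorm_bounded_family _ _ _ _ M) => k; case: (hM k).
have bQ : bounded_family (lqQ D).
  by apply: (@opnorm_bounded_family _ _ _ _ M) => k; case: (hM k).
have bR : bounded_family (lqR D).
  by apply: (@opnorm_bounded_family _ _ _ _ M) => k; case: (hM k).
have sQ t : (lqQ L t)^T = lqQ L t by exact: Qtilde_sym.
have gram_sym k l (S : 'M[R]_(k, l)) : (S *m S^T)^T = S *m S^T.
  by rewrite trmx_mul trmxK.
(* Spectral hypotheses become lower bounds on quadratic forms, the only shape in which the abstract
   result takes them. *)
have from_lambda (F : nat -> 'M[R]_n) c : (forall t, (F t)^T = F t) ->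
    (forall t, c <= lambda_min (F t)) ->
    forall t v, c * dot v v <= qform (F t) v.
  move=> sF hF t v; apply: le_trans (lambda_min_le v n0 (sF t)).
  by rewrite ler_wpM2r ?dot_ge0.
have Qq := from_lambda _ _ sQ hq.
have Bb := from_lambda _ _ (fun t => gram_sym _ _ (lqB L t)) hb.
have Aa := from_lambda _ _ (fun t => gram_sym _ _ (lqA L t)) ha.
apply: (receding_horizon_loss n0 _ sQ q0 Qq b0 Bb a0 Aa) => //.
- by move=> t; exact: posdef_Rtilde.
- exact: bounded_Atilde Aa.
- exact: bounded_Gamma.
- apply: bounded_Qtilde => // t; apply: posdef_psd.
  exact: posdef_ge (sQ t) q0 (Qq t).
- exact: bounded_Rtilde.
Qed.
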